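(* For every $(M,\varphi_M)$ in $\mathrm{Mod}_{\mathcal{O}_K^\flat,f}^{\varphi}$ of rank $r\in\mathbb{N}$, \[ t_{F}(M,\varphi_M)\leq t_{H}(M,\varphi_M)\quad\text{in}\quad\mathbb{R}_{\geq}^{r}. \]
   Context: $K$ is a perfectoid field extension of a finite extension $E$ of $\mathbb{Q}_p$ with residue field $\mathbb{F}_q$ and uniformizer $\pi$, $K^\flat$ its tilt with valuation ring $\mathcal{O}_K^\flat$; $\varphi(x)=x^q$. The absolute value of $K^\flat$ is normalized by $q|\varpi^q|=1$, where $\varpi\in\mathcal{O}_K^\flat$ is the reduction mod $\pi$ of a generator of $\ker(\theta:W_{\mathcal{O}_E}(\mathcal{O}_K^\flat)\twoheadrightarrow\mathcal{O}_K)$. $\mathrm{Mod}_{\mathcal{O}_K^\flat,f}^{\varphi}$ is the category of finite free $\mathcal{O}_K^\flat$-modules $M$ equipped with a $K^\flat$-linear isomorphism $\varphi_M:(\varphi^*M)\otimes K^\flat\to M\otimes K^\flat$. Hodge type: if $(e_1,\dots,e_r)$ is an $\mathcal{O}_K^\flat$-basis of $M$ and $x_1,\dots,x_r\in(K^\flat)^\times$, $|x_1|\ge\dots\ge|x_r|$, are such that $(x_ie_i)$ is a basis of the lattice $\varphi_M(\varphi^*M)\subset M\otimes K^\flat$ (such bases exist), then $t_H(M,\varphi_M)=(\log_q|x_1|\ge\dots\ge\log_q|x_r|)$, and $\deg(M)=\sum_i\log_q|x_i|$. Fargues type: strict subobjects of $M$ are the direct summands $N$ of $M$ such that $\varphi_M$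 restricts to an isomorphism $(\varphi^*N)\otimes K^\flat\to N\otimes K^\flat$. An object $X$ is semi-stable of slope $\mu\in\mathbb{R}$ if $\deg Y\le\mu\,\mathrm{rank}\,Y$ for all strict subobjects $Y$, with equality for $Y=X$. The Fargues filtration is the Harder-Narasimhan filtration: the unique decreasing $\mathbb{R}$-filtration by strict subobjects $\mathcal{F}^{\ge\gamma}_F$ such that each $\mathcal{F}_F^{\ge\gamma}/\mathcal{F}_F^{>\gamma}$ is semi-stable of slope $\gamma$. $t_F(M,\varphi_M)=(\gamma_1\ge\dots\ge\gamma_r)$ is its type: $\gamma$ occurs with multiplicity $\mathrm{rank}(\mathcal{F}_F^{\ge\gamma}/\mathcal{F}_F^{>\gamma})$. On $\mathbb{R}^r_\ge=\{(\gamma_1\ge\dots\ge\gamma_r)\}$: $(\gamma_i)\le(\gamma_i')$ iff $\gamma_1+\dots+\gamma_s\le\gamma'_1+\dots+\gamma'_s$ for all $s\le r$ with equality for $s=r$. *)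

(* Defs.v *)
(* MathComp / MathComp-Analysis. *)
From HB Require Import structures.
From mathcomp Require Import all_boot all_order all_algebra all_field.
From mathcomp Require Import all_classical all_reals all_analysis.
Set Implicit Arguments.
Unset Strict Implicit.
Unset Printing Implicit Defensive.
Import Order.TTheory GRing.Theory Num.Theory.
Import numFieldNormedType.Exports.
Local Open Scope classical_set_scope.
Local Open Scope ring_scope.

Record absval (R : realType) (K : fieldType) := AbsVal {
  av :> K -> R;
  av_ge0 : forall x, 0 <= av x;
  av_eq0 : forall x, av x = 0 <-> x = 0;
  avM : forall x y, av (x * y) = av x * av y;
  av_ultra : forall x y, av (x + y) <= Num.max (av x) (av y) }.

Lemma av0 (R : realType) (K : fieldType) (v : absval R K) : v 0 = 0.
Proof. exact/av_eq0. Qed.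

Lemma av1 (R : realType) (K : fieldType) (v : absval R K) : v 1 = 1.
Proof.
have v1 : v 1 != 0.
  by apply/eqP => /av_eq0 /eqP; rewrite oner_eq0.
by apply: (mulfI v1); rewrite -avM !mulr1.
Qed.

Lemma avN (R : realType) (K : fieldType) (v : absval R K) x : v (- x) = v x.
Proof.
suff vN1 : v (-1) = 1 by rewrite -mulN1r avM vN1 mul1r.
have : v (-1) ^+ 2 = 1 by rewrite expr2 -avM mulrNN mulr1 av1.
move/eqP; rewrite sqrf_eq1 => /orP[/eqP //|/eqP vN].
by have := av_ge0 v (-1); rewrite vN ler0N1.
Qed.

Definition av_le1 (R : realType) (K : fieldType) (v : absval R K) : {pred K} :=
  fun x => v x <= 1.

Lemma av_le1_subring (R : realType) (K : fieldType) (v : absval R K) :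
  subring_closed (av_le1 v).
Proof.
split=> [|x y|x y]; rewrite !unfold_in /av_le1 ?av1 // => vx vy.
- by rewrite (le_trans (av_ultra v _ _))// avN ge_max vx vy.
- by rewrite avM mulr_ile1// av_ge0.
Qed.

HB.instance Definition _ (R : realType) (K : fieldType) (v : absval R K) :=
  GRing.isSubringClosed.Build K (av_le1 v) (av_le1_subring v).

Record vring (R : realType) (K : fieldType) (v : absval R K) :=
  VRing { vr_val :> K; vr_valP : vr_val \in av_le1 v }.

HB.instance Definition _ (R : realType) (K : fieldType) (v : absval R K) :=
  [isSub for @vr_val R K v].
HB.instance Definition _ (R : realType) (K : fieldType) (v : absval R K) :=
  [Choice of vring v by <:].
HB.instance Definition _ (R : realType) (K : fieldType) (v : absval R K) :=
  [SubChoice_isSubComNzRing of vring v by <:].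

Section Pullback.
Context (R : realType) (E K : fieldType) (f : {rmorphism E -> K}).
Context (v : absval R K).

Let f_ge0 x : 0 <= v (f x). Proof. exact: av_ge0. Qed.
Let f_eq0 x : v (f x) = 0 <-> x = 0.
Proof.
split=> [/av_eq0/eqP|->]; last by rewrite rmorph0 av0.
by rewrite fmorph_eq0 => /eqP.
Qed.
Let fM x y : v (f (x * y)) = v (f x) * v (f y).
Proof. by rewrite rmorphM avM. Qed.
Let f_ultra x y : v (f (x + y)) <= Num.max (v (f x)) (v (f y)).
Proof. by rewrite rmorphD av_ultra. Qed.

Definition av_pull : absval R E := AbsVal f_ge0 f_eq0 fM f_ultra.
End Pullback.

Definition av_cvg (R : realType) (K : fieldType) (v : absval R K)
    (u : nat -> K) (l : K) : Prop :=
  v (u n - l) @[n --> \oo] --> (0 : R).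

Definition av_complete (R : realType) (K : fieldType) (v : absval R K) : Prop :=
  forall u : nat -> K,
    (forall eps : R, 0 < eps -> exists N : nat,
       forall m n, (N <= m)%N -> (N <= n)%N -> v (u m - u n) < eps) ->
    exists l, av_cvg v u l.

(* (F, v) is the completion of the rationals for the p-adic absolute value. *)
Record is_Qp (R : realType) (p : nat) (F : fieldType) (v : absval R F) : Prop :=
  IsQp {
    Qp_prime : prime p;
    Qp_norm : v p%:R = p%:R^-1;
    Qp_dense : forall (x : F) (eps : R), 0 < eps ->
      exists a : rat, v (x - ratr a) < eps;
    Qp_complete : av_complete v }.

Definition is_uniformizer (R : realType) (E : fieldType) (v : absval R E)
    (pi : vring v) : Prop :=
  pi != 0 /\ forall x : vring v, v x < 1 <-> exists y : vring v, x = pi * y.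

Definition is_residue_map (R : realType) (E : fieldType) (v : absval R E)
    (k : finFieldType) (res : {rmorphism vring v -> k}) : Prop :=
  (forall a : k, exists x, res x = a) /\ (forall x, res x = 0 <-> v x < 1).

Record is_perfectoid (R : realType) (p : nat) (K : fieldType)
    (v : absval R K) : Prop := IsPerfectoid {
  pfd_complete : av_complete v;
  pfd_res_char : v p%:R < 1;
  pfd_nondiscrete : forall eps : R, 0 < eps ->
    exists x : K, 1 - eps < v x < 1;
  pfd_frob : forall x : vring v, exists y z : vring v, x = y ^+ p + p%:R * z }.

(* L is the inverse limit of K along x |-> x ^+ p, [sh n] being the projection
   onto the n-th component (so [sh 0] is the sharp map); the addition of L is
   (x + y)_n = lim_k (x_(n+k) + y_(n+k)) ^ (p ^ k). *)
Record is_tilt (R : realType) (p : nat) (K : fieldType) (v : absval R K)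
    (L : fieldType) (sh : nat -> L -> K) : Prop := IsTilt {
  tilt_compat : forall n x, sh n.+1 x ^+ p = sh n x;
  tilt_inj : forall x y, (forall n, sh n x = sh n y) -> x = y;
  tilt_surj : forall u : nat -> K, (forall n, u n.+1 ^+ p = u n) ->
    exists x, forall n, sh n x = u n;
  tiltM : forall n x y, sh n (x * y) = sh n x * sh n y;
  tiltD : forall n x y,
    av_cvg v (fun k => (sh (n + k)%N x + sh (n + k)%N y) ^+ (p ^ k))
      (sh n (x + y)) }.

(* The absolute values of the tilt are the powers of x |-> |x^sharp|. *)
Definition is_tilt_absval (R : realType) (K : fieldType) (v : absval R K)
    (L : fieldType) (sh : nat -> L -> K) (w : absval R L) : Prop :=
  exists c : R, 0 < c /\ forall x, w x = v (sh 0%N x) `^ c.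

(* W_{OE}(A) for a perfect algebra A over the residue field of OE: the
   pi-torsion-free, pi-adically complete and separated OE-algebra W with
   W / pi W = A; [red] is reduction mod pi. *)
Record is_witt (OE A W : comNzRingType) (pi : OE) (iW : {rmorphism OE -> W})
    (red : {rmorphism W -> A}) : Prop := IsWitt {
  witt_red_surj : forall a, exists w, red w = a;
  witt_red_ker : forall w, red w = 0 <-> exists w', w = iW pi * w';
  witt_torsion_free : forall w, iW pi * w = 0 -> w = 0;
  witt_separated : forall w,
    (forall n, exists w', w = iW pi ^+ n * w') -> w = 0;
  witt_complete : forall u : nat -> W,
    (forall n, exists w', u n.+1 - u n = iW pi ^+ n * w') ->
    exists l, forall n, exists w', l - u n = iW pi ^+ n * w' }.

(* For A perfect there is exactly one multiplicative section of [red]. *)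
Definition is_teichmuller (A W : comNzRingType) (red : {rmorphism W -> A})
    (tau : A -> W) : Prop :=
  (forall a, red (tau a) = a) /\ (forall a b, tau (a * b) = tau a * tau b).

(* theta is the surjective OE-algebra morphism with theta [x] = x^sharp. *)
Record is_theta (R : realType) (E K L : fieldType) (v : absval R K)
    (w : absval R L) (iota : {rmorphism E -> K}) (sh : nat -> L -> K)
    (W : comNzRingType) (iW : {rmorphism vring (av_pull iota v) -> W})
    (tau : vring w -> W) (theta : {rmorphism W -> vring v}) : Prop := IsTheta {
  theta_alg : forall a : vring (av_pull iota v),
    theta (iW a) = iota (a : E) :> K;
  theta_teich : forall x : vring w, theta (tau x) = sh 0%N x :> K;
  theta_surj : forall y : vring v, exists z : W, theta z = y }.

Definition is_ker_generator (A B : comNzRingType) (f : {rmorphism A -> B})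
    (xi : A) : Prop :=
  forall a, f a = 0 <-> exists b, a = xi * b.

Definition Rge (R : realType) (r : nat) :=
  {t : r.-tuple R | sorted (fun x y => y <= x) t}.

Lemma sorted_nseq0 (R : realType) (r : nat) :
  sorted (fun x y : R => y <= x) (nseq_tuple r (0 : R)).
Proof. by case: r => // r /=; elim: r => //= r ->; rewrite lexx. Qed.

Definition Rge0 (R : realType) (r : nat) : Rge R r :=
  exist _ (nseq_tuple r 0) (sorted_nseq0 R r).

Definition partial_sum (R : realType) (r : nat) (t : Rge R r) (s : nat) : R :=
  \sum_(i < r | (i < s)%N) tnth (val t) i.

Definition Rge_le (R : realType) (r : nat) (t t' : Rge R r) : Prop :=
  (forall s, (s <= r)%N -> partial_sum t s <= partial_sum t' s) /\
  partial_sum t r = partial_sum t' r.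

(* Raw data: V = M (x) L, the lattice M inside V, and the Frobenius.  The
   Frobenius is recorded as the q-semilinear map v |-> phi_M (v (x) 1) on V
   rather than as the L-linear map phi_M on phi^* V; as L is perfect, phi^* V
   is V with scalars twisted by an automorphism of L, and phi_M is an
   isomorphism iff the semilinear map is bijective. *)
Record phimod (L : fieldType) := PhiMod {
  pm_space :> vectType L;
  pm_lat : set pm_space;
  pm_phi : pm_space -> pm_space }.

Definition rank (L : fieldType) (X : phimod L) : nat := \dim {: X}.

(* e is a basis over the valuation ring of the (full) lattice Lam of V. *)
Definition is_lattice_basis (R : realType) (L : fieldType) (v : absval R L)
    (V : vectType L) (n : nat) (Lam : set V) (e : n.-tuple V) : Prop :=
  basis_of {: V} e /\
  forall x, Lam x <->
    exists a : 'I_n -> vring v, x = \sum_i (a i : L) *: tnth e i.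

Record is_phimod (R : realType) (L : fieldType) (v : absval R L) (q : nat)
    (X : phimod L) : Prop := IsPhiMod {
  pm_free : exists e : (rank X).-tuple X, is_lattice_basis v (pm_lat (p := X)) e;
  pm_semilinear : linear_for (fun a x => a ^+ q *: x) (pm_phi (p := X));
  pm_bij : bijective (pm_phi (p := X)) }.

Definition vring_span (R : realType) (L : fieldType) (v : absval R L)
    (V : vectType L) (S : set V) : set V :=
  [set x | exists (n : nat) (a : 'I_n -> vring v) (s : 'I_n -> V),
     (forall i, S (s i)) /\ x = \sum_i (a i : L) *: s i].

(* The lattice phi_M (phi^* M). *)
Definition phi_lat (R : realType) (L : fieldType) (v : absval R L)
    (X : phimod L) : set X :=
  vring_span v (pm_phi (p := X) @` pm_lat (p := X)).

Definition logq (R : realType) (q : nat) (y : R) : R := ln y / ln q%:R.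

Definition is_hodge_type (R : realType) (L : fieldType) (v : absval R L)
    (q : nat) (X : phimod L) (t : Rge R (rank X)) : Prop :=
  exists (e : (rank X).-tuple X) (x : 'I_(rank X) -> L),
    [/\ is_lattice_basis v (pm_lat (p := X)) e,
        forall i, x i != 0,
        forall i j : 'I_(rank X), (i <= j)%N -> v (x j) <= v (x i),
        is_lattice_basis v (phi_lat v (X := X))
          [tuple x i *: tnth e i | i < rank X] &
        forall i, tnth (val t) i = logq q (v (x i))].

Definition hodge_type (R : realType) (L : fieldType) (v : absval R L)
    (q : nat) (X : phimod L) : Rge R (rank X) :=
  xget (Rge0 R (rank X)) [set t | is_hodge_type v q t].

Definition deg (R : realType) (L : fieldType) (v : absval R L)
    (q : nat) (X : phimod L) : R :=
  \sum_(i < rank X) tnth (val (hodge_type v q X)) i.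

(* The L-linear span of N, i.e. N (x) L for a submodule N. *)
Definition kspan (L : fieldType) (V : vectType L) (N : set V) : {vspace V} :=
  xget 0%VS [set U : {vspace V} |
    (forall x, N x -> x \in U) /\
    (forall U' : {vspace V}, (forall x, N x -> x \in U') -> (U <= U')%VS)].

Definition is_submodule (R : realType) (L : fieldType) (v : absval R L)
    (V : vectType L) (N : set V) : Prop :=
  N 0 /\ forall (a : vring v) (x y : V), N x -> N y -> N ((a : L) *: x + y).

Definition is_direct_summand (R : realType) (L : fieldType) (v : absval R L)
    (V : vectType L) (M N : set V) : Prop :=
  is_submodule v N /\
  exists N' : set V,
    [/\ is_submodule v N',
        forall x, M x <-> exists y z, [/\ N y, N' z & x = y + z] &
        forall x, N x -> N' x -> x = 0].

Definition is_strict_sub (R : realType) (L : fieldType) (v : absval R L)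
    (X : phimod L) (N : set X) : Prop :=
  is_direct_summand v (pm_lat (p := X)) N /\
  pm_phi (p := X) @` [set x | x \in kspan N] = [set x | x \in kspan N].

Definition sub_phimod (L : fieldType) (X : phimod L) (N : set X) : phimod L :=
  @PhiMod L (subvs_of (kspan N))
    [set x | N (vsval x)]
    (fun x => vsproj (kspan N) (pm_phi (vsval x))).

(* The quotient space X / U, realised on the chosen complement U^C of U;
   [quot_proj U] is the projection with kernel U. *)
Definition quot_proj (L : fieldType) (V : vectType L) (U : {vspace V}) (x : V) :
    subvs_of (U^C)%VS :=
  vsproj (U^C)%VS (x - projv U x).

Definition quot_phimod (L : fieldType) (X : phimod L) (N : set X) : phimod L :=
  @PhiMod L (subvs_of ((kspan N)^C)%VS)
    (quot_proj (kspan N) @` pm_lat (p := X))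
    (fun x => quot_proj (kspan N) (pm_phi (vsval x))).

(* N / N', for N' contained in N. *)
Definition subquot_phimod (L : fieldType) (X : phimod L) (N N' : set X) :
    phimod L :=
  quot_phimod (X := sub_phimod N) [set x | N' (vsval x)].

Definition semistable (R : realType) (L : fieldType) (v : absval R L)
    (q : nat) (X : phimod L) (mu : R) : Prop :=
  (forall N : set X, is_strict_sub v N ->
     deg v q (sub_phimod N) <= mu * (rank (sub_phimod N))%:R) /\
  deg v q X = mu * (rank X)%:R.

(* [F gamma] is F^{>= gamma}. *)
Definition fil_gt (R : realType) (T : Type) (F : R -> set T) (gamma : R) :
    set T :=
  [set x | exists gamma', gamma < gamma' /\ F gamma' x].

Definition gr (R : realType) (L : fieldType) (X : phimod L)
    (F : R -> set X) (gamma : R) : phimod L :=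
  subquot_phimod (F gamma) (fil_gt F gamma).

Record is_filtration (R : realType) (L : fieldType) (v : absval R L)
    (X : phimod L) (F : R -> set X) : Prop := IsFiltration {
  fil_strict : forall gamma, is_strict_sub v (F gamma);
  fil_decr : forall gamma gamma', gamma <= gamma' -> F gamma' `<=` F gamma;
  fil_exhaustive : exists gamma, F gamma = pm_lat (p := X);
  fil_separated : exists gamma, F gamma = [set 0];
  fil_left_cont : forall gamma x,
    (forall gamma', gamma' < gamma -> F gamma' x) -> F gamma x }.

Definition is_fargues_filtration (R : realType) (L : fieldType)
    (v : absval R L) (q : nat) (X : phimod L) (F : R -> set X) : Prop :=
  is_filtration v F /\ forall gamma, semistable v q (gr F gamma) gamma.

Definition is_fargues_type (R : realType) (L : fieldType) (v : absval R L)
    (q : nat) (X : phimod L) (t : Rge R (rank X)) : Prop :=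
  exists F : R -> set X, is_fargues_filtration v q F /\
    forall gamma, count_mem gamma (val t) = rank (gr F gamma).

(* Main.v *)
(* Degree and Hodge polygon are read off matrices: if A is the matrix of phi_M
   in a basis of M, then deg M = log_q |det A|, and writing A = P D Q with P, Q
   invertible over the valuation ring and D diagonal, every minor of size s is
   bounded by the product of the s largest |d_i|.  In a basis of M adapted to a
   strict subobject N, the matrix of phi_M is block triangular and its leading
   block is the matrix of phi_N.  Hence deg is additive on short exact
   sequences, and deg N is at most the sum of the first rank(N) Hodge slopes.
   Applied to the steps of the Fargues filtration, this bounds the vertices of
   the Fargues polygon by the concave Hodge polygon. *)
Require Import Defs.
From HB Require Import structures.
From mathcomp Require Import all_boot all_order all_algebra all_field.
From mathcomp Require Import all_classical all_reals all_analysis.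
From mathcomp Require Import perm ring.
Set Implicit Arguments.
Unset Strict Implicit.
Unset Printing Implicit Defensive.
Import Order.TTheory GRing.Theory Num.Theory.
Local Open Scope ring_scope.

(** The Hodge type and the degree are values of [xget], so using them on a subobject or a quotient
    first requires a frame there: an isomorphism from row vectors that carries integral vectors onto
    the lattice and turns the Frobenius into x |-> F(x) A. On subobjects, frames come from the Smith
    form of a basis of the spanned subspace, which is available although the valuation ring need not
    be Noetherian. The Fargues type is given only by its multiplicities, which makes its vertices
    awkward to index. The polygons are therefore compared through their Legendre transforms. For
    every gamma, the sum of the positive parts of t_i - gamma equals deg F^{>= gamma} - gamma rank
    F^{>= gamma}; the degree is at most a partial Hodge sum, and any partial sum of the h_i - gamma
    is at most the sum of their positive parts. These inequalities for all gamma, together with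
    equal totals, give back the majorization. *)

Section ValuationMatrices.
Context (R : realType) (L : fieldType) (v : absval R L).

(** * Integral matrices, elementary divisors and minors *)

Definition mxO m n (A : 'M[L]_(m, n)) := forall i j, v (A i j) <= 1.

(** GL_n of the valuation ring: by the adjugate formula, an integral matrix has an integral inverse
    exactly when its determinant has absolute value 1. *)
Definition glO n (P : 'M[L]_n) := mxO P /\ v (\det P) = 1.

Lemma av_le1E x : (v x <= 1) = (x \in av_le1 v).
Proof. by []. Qed.

Lemma mxOP m n (A : 'M[L]_(m, n)) : mxO A <-> A \is a mxOver (av_le1 v).
Proof. by split=> [h|/mxOverP h]; [apply/mxOverP|] => i j; [rewrite -av_le1E|rewrite av_le1E]. Qed.

Lemma mxO_mul m n p (A : 'M[L]_(m, n)) (B : 'M[L]_(n, p)) :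
  mxO A -> mxO B -> mxO (A *m B).
Proof. by move=> /mxOP hA /mxOP hB; apply/mxOP/mxOverM. Qed.

Lemma mxO1 n : mxO (1%:M : 'M[L]_n).
Proof. by move=> i j; rewrite mxE; case: eqP; rewrite ?av1 ?av0 ?ler01. Qed.

Lemma mxO_det n (A : 'M[L]_n) : mxO A -> v (\det A) <= 1.
Proof.
move=> hA; rewrite av_le1E /determinant rpred_sum // => s _; apply: rpredM.
  by rewrite rpredX // rpredN rpred1.
by apply: rpred_prod => i _; rewrite -av_le1E.
Qed.

Lemma glO_unit n (P : 'M[L]_n) : glO P -> P \in unitmx.
Proof.
case=> _ d1; rewrite unitmxE unitfE; apply/eqP => d0.
by move: d1; rewrite d0 av0 => /eqP; rewrite eq_sym oner_eq0.
Qed.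

Lemma glO_mul n (P Q : 'M[L]_n) : glO P -> glO Q -> glO (P *m Q).
Proof.
move=> [hP dP] [hQ dQ]; split; first exact: mxO_mul.
by rewrite det_mulmx avM dP dQ mulr1.
Qed.

Lemma avV x : v x^-1 = (v x)^-1.
Proof.
have [->|x0] := eqVneq x 0; first by rewrite invr0 av0 invr0.
have vx : v x != 0 by apply/eqP => /av_eq0/eqP; rewrite (negbTE x0).
by apply: (mulfI vx); rewrite -avM !divff // av1.
Qed.

Lemma av_gt0 x : x != 0 -> 0 < v x.
Proof.
by move=> x0; rewrite lt_def av_ge0 andbT; apply/eqP => /av_eq0/eqP; rewrite (negbTE x0).
Qed.

Lemma av_prod I (r : seq I) (P : pred I) (F : I -> L) :
  v (\prod_(i <- r | P i) F i) = \prod_(i <- r | P i) v (F i).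
Proof. by apply: (big_morph v (avM v) (av1 v)). Qed.

Lemma av_sum I (r : seq I) (P : pred I) (F : I -> L) c :
  0 <= c -> (forall i, P i -> v (F i) <= c) -> v (\sum_(i <- r | P i) F i) <= c.
Proof.
move=> c0 h; elim/big_ind: _ => // [|x y hx hy]; first by rewrite av0.
by rewrite (le_trans (av_ultra _ _ _))// ge_max hx hy.
Qed.

Lemma glO_inv n (P : 'M[L]_n) : glO P -> glO (invmx P).
Proof.
move=> gP; have [hP dP] := gP; split; last first.
  by rewrite det_inv avV dP invr1.
move=> i j; rewrite /invmx (glO_unit gP) !mxE avM avV dP invr1 mul1r.
rewrite avM -[X in _ <= X]mulr1 ler_pM ?av_ge0 //.
  by rewrite av_le1E rpredX // rpredN rpred1.
by apply: mxO_det => a b; rewrite !mxE.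
Qed.

Lemma glO_mulmx1 n (P Q : 'M[L]_n) : mxO P -> mxO Q -> P *m Q = 1%:M -> glO P.
Proof.
move=> hP hQ PQ; split => //; apply/eqP; rewrite eq_le mxO_det //=.
have := congr1 v (congr1 determinant PQ); rewrite det1 det_mulmx avM av1 => <-.
by rewrite ler_piMr ?av_ge0 // mxO_det.
Qed.

(** Indexing by [nat] lets the recursion in [smith] prepend a pivot by a shift; values of [d] past
    the last row or column do not appear in the matrix. *)
Definition rdiag m n (d : nat -> L) : 'M[L]_(m, n) :=
  \matrix_(i, j) (if i == j :> nat then d i else 0).

Lemma glO_block1 n (P : 'M[L]_n) : glO P ->
  glO (block_mx 1%:M 0 0 P : 'M[L]_(1 + n)).
Proof.
move=> [hP dP]; split; last by rewrite det_ublock det1 mul1r.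
move=> i j; case: (split_ordP i) => a ->; case: (split_ordP j) => b ->.
- by rewrite block_mxEul; apply: mxO1.
- by rewrite block_mxEur mxE av0 ler01.
- by rewrite block_mxEdl mxE av0 ler01.
- by rewrite block_mxEdr.
Qed.

Lemma glO_lower n (w : 'cV[L]_n) : mxO w ->
  glO (block_mx 1%:M 0 w 1%:M : 'M[L]_(1 + n)).
Proof.
move=> hw; split; last by rewrite det_lblock !det1 mul1r av1.
move=> i j; case: (split_ordP i) => a ->; case: (split_ordP j) => b ->.
- by rewrite block_mxEul; apply: mxO1.
- by rewrite block_mxEur mxE av0 ler01.
- by rewrite block_mxEdl.
- by rewrite block_mxEdr; apply: mxO1.
Qed.

Lemma glO_tr n (P : 'M[L]_n) : glO P -> glO P^T.
Proof. by move=> [hP dP]; split; [move=> i j; rewrite mxE|rewrite det_tr]. Qed.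

Lemma glO_tperm n (i j : 'I_n) : glO (tperm_mx i j).
Proof.
split; first by move=> a b; rewrite !mxE; case: (_ == _); rewrite ?av1 ?av0 ?ler01.
by rewrite det_perm; case: (odd_perm _); rewrite ?expr1 ?expr0 ?avN av1.
Qed.

Lemma mx_bounded m n (A : 'M[L]_(m, n)) :
  exists c, 0 <= c /\ forall i j, v (A i j) <= c.
Proof.
have row0 i : 0 <= \sum_j v (A i j) by apply: sumr_ge0 => j _; apply: av_ge0.
exists (\sum_i \sum_j v (A i j)); split; first by apply: sumr_ge0.
move=> i j; rewrite (bigD1 i) //= (bigD1 j) //= -addrA lerDl addr_ge0 //.
  by apply: sumr_ge0 => ? _; apply: av_ge0.
by apply: sumr_ge0.
Qed.

(* Elimination with a pivot of maximal absolute value only divides by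
   entries that dominate everything else, so the multipliers are integral. *)
Lemma smith m n (A : 'M[L]_(m, n)) (c : R) :
  0 <= c -> (forall i j, v (A i j) <= c) ->
  exists (P : 'M[L]_m) (Q : 'M[L]_n) (d : nat -> L),
    [/\ glO P, glO Q, P *m A *m Q = rdiag m n d,
        forall i j, (i <= j)%N -> v (d j) <= v (d i) &
        forall i, v (d i) <= c].
Proof.
have gl1 k : glO (1%:M : 'M[L]_k) by split; [apply: mxO1|rewrite det1 av1].
elim: m n A c => [|m IH] [|n] A c c0 hA.
1-3: exists 1%:M, 1%:M, (fun=> 0); split=> // [|i]; rewrite ?av0 //;
  by apply/matrixP => i j; case: i => // i; case: j.
pose ij0 := [arg max_(ij > (ord0, ord0) : 'I_m.+1 * 'I_n.+1) v (A ij.1 ij.2)]%O.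
pose a := A ij0.1 ij0.2.
have ha i j : v (A i j) <= v a.
  by rewrite /a /ij0; case: arg_maxP => // ij _ /(_ (i, j)); apply.
have [A1 [A1E A100 hA1]] : exists A1 : 'M[L]_(1 + m, 1 + n),
    [/\ A1 = tperm_mx ord0 ij0.1 *m A *m tperm_mx ord0 ij0.2,
        A1 0 0 = a & forall i j, v (A1 i j) <= v a].
  exists (tperm_mx ord0 ij0.1 *m A *m tperm_mx ord0 ij0.2).
  rewrite -xcolE -xrowE; split=> // [|i j]; last by rewrite !mxE.
  by rewrite !mxE !tpermL.
have [a0|a0] := eqVneq a 0.
  exists 1%:M, 1%:M, (fun=> 0); split=> // [|i]; rewrite ?av0 //.
  rewrite mul1mx mulmx1; apply/matrixP => i j; rewrite !mxE if_same.
  by apply/(av_eq0 v)/le_anti; rewrite av_ge0 (le_trans (ha i j)) // a0 av0.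
pose w := - (a^-1 *: dlsubmx A1); pose u := - (a^-1 *: ursubmx A1).
have div1 x : v x <= v a -> v (- (a^-1 * x)) <= 1.
  by move=> hx; rewrite avN avM avV mulrC ler_pdivrMr ?mul1r ?av_gt0.
have hw : mxO w by move=> i j; rewrite !mxE div1 // hA1.
have hu : mxO u by move=> i j; rewrite !mxE div1 // hA1.
pose E1 : 'M[L]_(1 + m) := block_mx 1%:M 0 w 1%:M.
pose E2 : 'M[L]_(1 + n) := block_mx 1%:M u 0 1%:M.
have gE1 : glO E1 by apply: glO_lower.
have gE2 : glO E2.
  rewrite -[E2]trmxK; apply: glO_tr; rewrite tr_block_mx !trmx1 trmx0.
  by apply: glO_lower => i j; rewrite mxE.
pose B := w *m ursubmx A1 + drsubmx A1.
have EA : E1 *m A1 *m E2 = block_mx a%:M 0 0 B.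
  have A1b : A1 = block_mx a%:M (ursubmx A1) (dlsubmx A1) (drsubmx A1).
    rewrite -[LHS]submxK; congr block_mx.
    by rewrite [LHS]mx11_scalar !mxE -A100; congr (A1 _ _)%:M; apply: val_inj.
  rewrite A1b /E1 /E2 !mulmx_block !mul1mx !mul0mx !mulmx0 !addr0 !mulmx1.
  have w0 : w *m a%:M + dlsubmx A1 = 0.
    by rewrite mul_mx_scalar scalerN scalerA divff // scale1r addNr.
  have u0 : a%:M *m u + ursubmx A1 = 0.
    by rewrite mul_scalar_mx scalerN scalerA divff // scale1r addNr.
  by rewrite w0 u0 mul0mx add0r.
have hB i j : v (B i j) <= v a.
  rewrite /B mxE (le_trans (av_ultra _ _ _)) // ge_max !mxE hA1 andbT.
  by rewrite big_ord1 avM -[v a]mul1r ler_pM ?av_ge0 // !mxE.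
(* Taking [v a] as the bound makes every later diagonal entry at most the pivot, which is what keeps
   the extended sequence sorted. *)
have [P [Q [d [gP gQ PBQ ds da]]]] := IH n B (v a) (av_ge0 v a) hB.
pose P1 : 'M[L]_(1 + m) := block_mx 1%:M 0 0 P.
pose Q1 : 'M[L]_(1 + n) := block_mx 1%:M 0 0 Q.
exists (P1 *m E1 *m (tperm_mx ord0 ij0.1 : 'M[L]_(1 + m))),
  ((tperm_mx ord0 ij0.2 : 'M[L]_(1 + n)) *m E2 *m Q1),
  (fun i => if i is k.+1 then d k else a); split.
- by do !apply: glO_mul => //; [apply: glO_block1|apply: glO_tperm].
- by do !apply: glO_mul => //; [apply: glO_tperm|apply: glO_block1].
- transitivity (P1 *m (E1 *m A1 *m E2) *m Q1); first by rewrite A1E !mulmxA.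
  rewrite EA !mulmx_block !(mul1mx, mul0mx, mulmx0, addr0, add0r, mulmx1) PBQ.
  rewrite -[m.+1]/(1 + m)%N -[n.+1]/(1 + n)%N; apply/matrixP => i j.
  case: (@split_ordP 1 m i) => k ->; case: (@split_ordP 1 n j) => l ->.
  + by rewrite block_mxEul !mxE !ord1.
  + by rewrite block_mxEur !mxE !ord1.
  + by rewrite block_mxEdl !mxE !ord1.
  + by rewrite block_mxEdr !mxE.
- by move=> [|i] [|j] //= ij; apply: ds.
- move=> [|i] /=; first exact: hA.
  by rewrite (le_trans (da i)) // hA.
Qed.

(** Cauchy-Binet before its terms are grouped by image: no subset has to be enumerated, and a
    non-injective map contributes a determinant with two equal rows. *)
Lemma det_mulmx_rect s r (A : 'M[L]_(s, r)) (B : 'M[L]_(r, s)) :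
  \det (A *m B) = \sum_(f : {ffun 'I_s -> 'I_r})
     (\prod_i A i (f i)) * \det (\matrix_(i, j) B (f i) j).
Proof.
pose AB (t : 'S_s) i j := A i j * B j (t i).
transitivity (\sum_(f : {ffun 'I_s -> 'I_r})
    \sum_(t : 'S_s) (-1) ^+ t * \prod_i AB t i (f i)).
  rewrite exchange_big; apply: eq_bigr => /= t _; rewrite -big_distrr /=.
  congr (_ * _); rewrite -(bigA_distr_bigA (AB t)) /=.
  by apply: eq_bigr => x _; rewrite mxE.
apply: eq_bigr => f _; rewrite big_distrr /=; apply: eq_bigr => t _.
rewrite big_split /= mulrCA; congr (_ * (_ * _)).
by apply: eq_bigr => i _; rewrite mxE.
Qed.

(** After division by the smallest leading value [c], factors with a leading index are at least 1
    and all others at most 1. Once the common factors cancel, 1 separates the two products. *)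
Lemma prod_inj_le a b (d : 'I_(a + b) -> L) (f : 'I_a -> 'I_(a + b)) :
  (forall i, d i != 0) -> (forall i j : 'I_(a + b), (i <= j)%N -> v (d j) <= v (d i)) ->
  injective f -> \prod_i v (d (f i)) <= \prod_(i < a) v (d (lshift b i)).
Proof.
case: a d f => [|a] d f d0 ds finj; first by rewrite !big_ord0.
pose c := v (d (lshift b (ord_max : 'I_a.+1))).
have c0 : 0 < c by apply: av_gt0.
pose g i := v (d i) / c.
have g0 i : 0 <= g i by rewrite divr_ge0 ?av_ge0 // ltW.
suff : \prod_i g (f i) <= \prod_(i < a.+1) g (lshift b i).
  by rewrite !big_split /= ler_pM2r // prodr_const exprn_gt0 ?invr_gt0.
pose S := [set i : 'I_(a.+1 + b) | (i < a.+1)%N].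
have gS i : i \in S -> 1 <= g i.
  by rewrite inE => hi; rewrite /g ler_pdivlMr // mul1r ds //=; move: hi; rewrite ltnS.
have gNS i : i \notin S -> g i <= 1.
  by rewrite inE -leqNgt => hi; rewrite /g ler_pdivrMr // mul1r ds //= ltnW.
have -> : \prod_i g (f i) = \prod_(i in f @: 'I_a.+1) g i.
  by rewrite big_imset //= => x y _ _; apply: finj.
have -> : \prod_(i < a.+1) g (lshift b i) = \prod_(i in S) g i.
  rewrite (@reindex_onto _ _ _ _ _ (lshift b) (fun i => inord i)) /=.
    apply: eq_bigl => i; rewrite inE /= ltn_ord /=; apply/esym/eqP/val_inj.
    by rewrite /= inordK.
  by move=> i; rewrite inE => hi; apply: val_inj; rewrite /= inordK.
rewrite (big_setID S) /= [leRHS](big_setID (f @: 'I_a.+1)) /= finset.setIC.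
apply: ler_wpM2l; first by apply: prodr_ge0.
apply: (@le_trans _ _ 1).
  by apply: prodr_ile1 => i; rewrite inE => /andP[? _]; rewrite g0 gNS.
by apply: (big_ind (fun x => 1 <= x)) => // [x y|i]; [exact: mulr_ege1|rewrite inE => /andP[_ /gS]].
Qed.

(** Each surviving Cauchy-Binet term is a product of distinct [d i], entries of [P] and a minor of
    [Q], the last two integral; the ultrametric inequality reduces the sum to its terms. *)
Lemma det_ul_le a b (P Q : 'M[L]_(a + b)) (d : 'I_(a + b) -> L) :
  mxO P -> mxO Q -> (forall i, d i != 0) ->
  (forall i j : 'I_(a + b), (i <= j)%N -> v (d j) <= v (d i)) ->
  v (\det (ulsubmx (P *m diag_mx (\row_i d i) *m Q))) <=
    \prod_(i < a) v (d (lshift b i)).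
Proof.
move=> hP hQ d0 ds; set D := diag_mx _.
have -> : ulsubmx (P *m D *m Q) = (usubmx P *m D) *m lsubmx Q.
  by apply/matrixP => i j; rewrite !mxE; apply: eq_bigr => k _; rewrite !mxE;
    congr (_ * _); apply: eq_bigr => l _; rewrite !mxE.
rewrite det_mulmx_rect; apply: av_sum => [|f _].
  by apply: prodr_ge0 => i _; apply: av_ge0.
have [/injectiveP finj|/injectivePn[i [j ij fij]]] := boolP (injectiveb f); last first.
  rewrite (determinant_alternate ij) ?mulr0 ?av0; last by move=> k; rewrite !mxE fij.
  by apply: prodr_ge0 => k _; apply: av_ge0.
rewrite avM -[leRHS]mulr1 ler_pM ?av_ge0 //; last first.
  by apply: mxO_det => i j; rewrite !mxE.
rewrite av_prod (le_trans _ (prod_inj_le d0 ds finj)) //.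
apply: ler_prod => i _; rewrite av_ge0 /= mul_mx_diag !mxE avM.
by rewrite -[leRHS]mul1r ler_wpM2r ?av_ge0.
Qed.

End ValuationMatrices.

(** * Lattice bases as coordinate isomorphisms *)

Section Frames.
Context (R : realType) (L : fieldType) (v : absval R L).

Section Comb.
Context (V : vectType L) (n : nat).

Definition comb (e : 'I_n -> V) (x : 'rV[L]_n) : V := \sum_i x 0 i *: e i.

Lemma comb_linear e : linear (comb e).
Proof.
move=> a x y; rewrite /comb scaler_sumr -big_split /=; apply: eq_bigr => i _.
by rewrite !mxE scalerDl scalerA.
Qed.

HB.instance Definition _ e := GRing.isLinear.Build L _ _ _ (comb e) (comb_linear e).

Lemma linear_comb (h : {linear 'rV[L]_n -> V}) x :
  h x = comb (fun i => h (delta_mx 0 i)) x.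
Proof.
rewrite {1}[x]row_sum_delta linear_sum; apply: eq_bigr => i _.
by rewrite linearZ.
Qed.

Lemma basis_comb (e : n.-tuple V) : basis_of {:V} e <-> bijective (comb (tnth e)).
Proof.
split=> [be|[g gK Kg]].
  exists (fun y => \row_i coord e i y) => [x|y].
    apply/rowP => j; rewrite mxE /comb.
    under eq_bigr => i _ do rewrite (tnth_nth 0).
    by rewrite coord_sum_free ?(basis_free be).
  rewrite [RHS](coord_basis be) ?memvf //; apply: eq_bigr => i _.
  by rewrite mxE (tnth_nth 0).
rewrite /basis_of; apply/andP; split.
  rewrite eqEsubv subvf; apply/subvP => y _; rewrite -[y]Kg; apply: rpred_sum => i _.
  by apply: rpredZ; apply: memv_span; apply: mem_tnth.
apply/freeP => k hk i.
have /(can_inj gK)/rowP/(_ i) : comb (tnth e) (\row_i k i) = comb (tnth e) 0.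
  rewrite linear0 -[RHS]hk; apply: eq_bigr => j _.
  by rewrite mxE (tnth_nth 0).
by rewrite !mxE.
Qed.

End Comb.

(* A basis of the lattice Lam, as a coordinate isomorphism taking the vectors
   with integral entries to Lam. *)
Definition lframe (V : vectType L) (Lam : set V) n (h : {linear 'rV[L]_n -> V}) :=
  bijective h /\ forall x, Lam (h x) <-> mxO v x.

Lemma lattice_basis_lframe (V : vectType L) (Lam : set V) n (e : n.-tuple V) :
  is_lattice_basis v Lam e <-> lframe Lam (comb (tnth e)).
Proof.
split=> [[/basis_comb be he]|[be he]].
  split=> // x; rewrite he; split=> [[a xa]|hx].
    have -> : x = \row_i (a i : L).
      by apply: (bij_inj be); rewrite xa; apply: eq_bigr => i _; rewrite mxE.
    by move=> i j; rewrite mxE; apply: (vr_valP (a j)).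
  exists (fun i => VRing (hx 0 i : x 0 i \in av_le1 v)).
  by apply: eq_bigr.
split; first exact/basis_comb.
have [g gK Kg] := be => x; split=> [|[a xa]].
  rewrite -[x]Kg he => hx.
  exists (fun i => VRing (hx 0 i : g x 0 i \in av_le1 v)).
  by apply: eq_bigr.
have -> : x = comb (tnth e) (\row_i (a i : L)).
  by rewrite xa; apply: eq_bigr => i _; rewrite mxE.
by apply/he => i j; rewrite mxE; apply: (vr_valP (a j)).
Qed.

Lemma lframe_comb (V : vectType L) (Lam : set V) n (h : {linear 'rV[L]_n -> V})
    (e : 'I_n -> V) :
  (forall i, e i = h (delta_mx 0 i)) -> lframe Lam h -> lframe Lam (comb e).
Proof.
move=> eE [bh hh]; have E : comb e =1 h.
  by move=> x; rewrite [RHS]linear_comb; apply: eq_bigr => i _; rewrite eE.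
by split=> [|x]; [exact: eq_bij bh _ (fsym E)|rewrite -hh -(E x)].
Qed.

Lemma bij_dim (V : vectType L) n (h : {linear 'rV[L]_n -> V}) :
  bijective h -> n = \dim {:V}.
Proof.
move=> bh; pose e := [tuple h (delta_mx 0 i) | i < n].
have : basis_of {:V} e.
  apply/basis_comb; apply: eq_bij bh _ _ => x.
  by rewrite linear_comb; apply: eq_bigr => i _; rewrite tnth_mktuple.
by move/size_basis.
Qed.

Lemma linear_mx (V : vectType L) m n (h : {linear 'rV[L]_n -> V})
    (h' : {linear 'rV[L]_m -> V}) :
  bijective h -> exists P : 'M[L]_(m, n), forall x, h' x = h (x *m P).
Proof.
case=> g gK Kg; exists (\matrix_i g (h' (delta_mx 0 i))) => x.
rewrite [x in RHS]row_sum_delta mulmx_suml linear_sum linear_comb.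
apply: eq_bigr => i _.
by rewrite -scalemxAl linearZ /= -rowE rowK Kg.
Qed.

Lemma lframe_trans (V : vectType L) (Lam : set V) n (h h' : {linear 'rV[L]_n -> V}) :
  lframe Lam h -> lframe Lam h' ->
  exists P : 'M[L]_n, glO v P /\ forall x, h' x = h (x *m P).
Proof.
move=> [bh lh] [bh' lh'].
have O1 (i : 'I_n) : mxO v (delta_mx 0 i : 'rV[L]_n).
  by move=> a b; rewrite mxE; case: (_ && _); rewrite ?av1 ?av0 ?ler01.
have [P hP] := linear_mx h' bh; have [Q hQ] := linear_mx h bh'.
exists P; split=> //; apply: (@glO_mulmx1 _ _ _ _ _ Q).
- move=> i j; have /lh' := O1 i; rewrite hP => /lh/(_ 0 j).
  by rewrite -rowE mxE.
- move=> i j; have /lh := O1 i; rewrite hQ => /lh'/(_ 0 j).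
  by rewrite -rowE mxE.
- apply/row_matrixP => i; rewrite !rowE; apply: (bij_inj bh').
  by rewrite mulmxA -hQ -hP mulmx1.
Qed.

Lemma mulmxr_bij n (P : 'M[L]_n) :
  P \in unitmx -> bijective (mulmxr P : 'rV[L]_n -> 'rV[L]_n).
Proof. by move=> uP; exists (mulmxr (invmx P)) => x /=; rewrite ?mulmxK ?mulmxKV. Qed.

Lemma lframe_change (V : vectType L) (Lam : set V) n (h : {linear 'rV[L]_n -> V})
    (P : 'M[L]_n) : glO v P -> lframe Lam h -> lframe Lam (h \o mulmxr P).
Proof.
move=> gP [bh lh]; split.
  exact: bij_comp bh (mulmxr_bij (glO_unit gP)).
move=> x; rewrite /= lh; split=> hx.
  rewrite -[x](mulmxK (glO_unit gP)); apply: mxO_mul => //.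
  by have [] := glO_inv gP.
by apply: mxO_mul => //; case: gP.
Qed.

(** * The Frobenius in coordinates: Hodge type and degree *)

Section Phi.
Context (q : nat) (F : {rmorphism L -> L}).
Hypotheses (q1 : (1 < q)%N) (hF : forall x, F x = x ^+ q).

(** Vectors are rows, so row i of [A] holds the coordinates of the Frobenius of the i-th basis
    vector, and stability of the span of the first vectors kills the upper right block.
    Invertibility of [A] says that the linearized Frobenius is an isomorphism. *)
Definition pframe (Y : phimod L) n (h : {linear 'rV[L]_n -> Y}) (A : 'M[L]_n) :=
  [/\ lframe (pm_lat (p := Y)) h,
      forall x, pm_phi (h x) = h (map_mx F x *m A) & A \in unitmx].

Lemma map_delta n (i : 'I_n) : map_mx F (delta_mx 0 i : 'rV[L]_n) = delta_mx 0 i.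
Proof. by apply/rowP => j; rewrite !mxE; case: (_ && _); rewrite ?rmorph1 ?rmorph0. Qed.

Lemma mxO_map m n (x : 'M[L]_(m, n)) : mxO v x -> mxO v (map_mx F x).
Proof. by move=> hx i j; rewrite mxE hF av_le1E rpredX // -av_le1E. Qed.

(** [F] preserves integrality and fixes the unit vectors, so the span of the image of the lattice is
    generated by the rows of [A]. *)
Lemma phi_lat_lframe (Y : phimod L) n (h : {linear 'rV[L]_n -> Y}) (A : 'M[L]_n) :
  pframe h A -> lframe (phi_lat v (X := Y)) (h \o mulmxr A).
Proof.
move=> [[bh lh] ph uA]; have [g gK Kg] := bh; split.
  exact: bij_comp bh (mulmxr_bij uA).
move=> x; split=> /= [[m [a [s [hs xE]]]]|hx].
  have y_ i : exists y, mxO v y /\ s i = h (map_mx F y *m A).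
    have [z zM <-] := hs i; exists (g z).
    by rewrite -ph Kg; split=> //; apply/lh; rewrite Kg.
  have {y_}[y hy] := choice y_.
  have -> : x = \sum_i (a i : L) *: map_mx F (y i).
    apply: (can_inj (mulmxK uA)); apply: (can_inj gK); rewrite xE.
    rewrite mulmx_suml linear_sum; apply: eq_bigr => i _.
    by rewrite -scalemxAl linearZ /=; have [_ ->] := hy i.
  move=> i j; rewrite summxE; apply: av_sum => // k _; rewrite mxE avM mulr_ile1 ?av_ge0 //.
    exact: (vr_valP (a k)).
  by apply: mxO_map; have [] := hy k.
exists n, (fun i => VRing (hx 0 i : x 0 i \in av_le1 v)),
  (fun i => h (delta_mx 0 i *m A)); split=> [i|].
  exists (h (delta_mx 0 i)); last by rewrite ph map_delta.
  apply/lh => k j; rewrite mxE.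
  by case: (_ && _); rewrite ?av1 ?av0 ?ler01.
rewrite -[h _]/((h \o mulmxr A) x) linear_comb.
by apply: eq_bigr => i _.
Qed.

Lemma det_diag_row n (d : 'I_n -> L) : \det (diag_mx (\row_i d i)) = \prod_i d i.
Proof. by rewrite det_diag; apply: eq_bigr => i _; rewrite mxE. Qed.

Lemma lnq_gt0 : 0 < ln (q%:R : R).
Proof. by rewrite ln_gt0 // ltr1n. Qed.

Lemma logq_le x y : 0 < x -> x <= y -> logq q x <= logq q y :> R.
Proof.
move=> x0 xy; rewrite /logq ler_pM2r ?invr_gt0 ?lnq_gt0 // ler_ln ?posrE //.
exact: lt_le_trans xy.
Qed.

Lemma logqM x y : 0 < x -> 0 < y -> logq q (x * y) = logq q x + logq q y :> R.
Proof. by move=> x0 y0; rewrite /logq lnM ?posrE // mulrDl. Qed.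

Lemma logq1 : logq q 1 = 0 :> R.
Proof. by rewrite /logq ln1 mul0r. Qed.

Lemma logq_prod I (r : seq I) (P : pred I) (f : I -> L) :
  (forall i, f i != 0) ->
  logq q (v (\prod_(i <- r | P i) f i)) = \sum_(i <- r | P i) logq q (v (f i)).
Proof.
move=> f0.
suff [] : \prod_(i <- r | P i) f i != 0 /\
  logq q (v (\prod_(i <- r | P i) f i)) = \sum_(i <- r | P i) logq q (v (f i)) by [].
elim/big_rec2: _ => [|i y x _ [x0 xE]]; first by rewrite oner_neq0 av1 logq1.
by rewrite mulf_neq0 // avM logqM ?av_gt0 // xE.
Qed.

(** If P A Q = D, the rows of Q^-1 give a basis of M, and their multiples by the d_i are the rows of
    D Q^-1 = P A, a basis of the Frobenius lattice. *)
Lemma hodge_type_exists (Y : phimod L) n (h : {linear 'rV[L]_n -> Y}) (A : 'M[L]_n) :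
  pframe h A -> exists t, is_hodge_type v q (X := Y) t.
Proof.
move=> fr; have lfr := phi_lat_lframe fr; have [[bh lh] ph uA] := fr.
have en : n = rank Y by apply: bij_dim bh.
subst n.
have [c [c0 cA]] := mx_bounded v A.
have [P [Q [d [gP gQ PAQ ds _]]]] := smith c0 cA.
pose k : {linear 'rV[L]_(rank Y) -> Y} := h \o mulmxr (invmx Q).
have DE : rdiag (rank Y) (rank Y) d = diag_mx (\row_i d i).
  by apply/matrixP => i j; rewrite !mxE; case: (i =P j) => [->|/val_eqP/eqP ij];
    [rewrite eqxx mulr1n|rewrite (introF eqP ij) mulr0n].
have d0 (i : 'I_(rank Y)) : d i != 0.
  have : \det (rdiag (rank Y) (rank Y) d) != 0.
    by rewrite -PAQ -unitfE -unitmxE !unitmx_mul uA !(@glO_unit _ _ v).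
  by rewrite DE det_diag_row => /prodf_neq0/(_ i isT).
have ts : sorted (fun x y : R => y <= x)
    [tuple logq q (v (d i)) | i < rank Y].
  apply/(sortedP 0) => i; rewrite size_tuple => hi.
  have -> : i = Ordinal (ltnW hi) by [].
  rewrite -[i.+1]/(val (Ordinal hi)) !nth_mktuple.
  by rewrite logq_le ?av_gt0 //= ?ds // (d0 (Ordinal hi)).
exists (exist _ [tuple logq q (v (d i)) | i < rank Y] ts), [tuple k (delta_mx 0 i) | i < rank Y], (fun i => d i); split.
- apply/lattice_basis_lframe; apply: (@lframe_comb _ _ _ k) => [i|].
    by rewrite tnth_mktuple.
  by apply: lframe_change; [apply: glO_inv|split].
- by [].
- by move=> i j; apply: ds.
- apply/lattice_basis_lframe.
  apply: (@lframe_comb _ _ _ (h \o mulmxr A \o mulmxr P)) => [i|]; last first.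
    exact: lframe_change.
  rewrite !tnth_mktuple -linearZ /=; congr (h _).
  rewrite -[A](mulmxK (glO_unit gQ)) !mulmxA -(mulmxA _ P) -(mulmxA _ _ Q) PAQ.
  congr (_ *m _); rewrite DE -rowE; apply/rowP => j; rewrite !mxE.
  by rewrite eqxx /= eq_sym mulr_natr.
- by move=> i; rewrite tnth_mktuple.
Qed.

(** Stated for an arbitrary Hodge type, hence valid for the one that [xget] selects: [P] and [Q]
    arise by comparing its two bases with the frames [h \o mulmxr A] and [h]. *)
Lemma hodge_decomp (Y : phimod L) n (h : {linear 'rV[L]_n -> Y}) (A : 'M[L]_n) t :
  pframe h A -> is_hodge_type v q (X := Y) t ->
  exists (P Q : 'M[L]_n) (d : 'I_n -> L),
  [/\ glO v P, glO v Q, A = P *m diag_mx (\row_i d i) *m Q &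
  [/\ (forall i, d i != 0),
      (forall i j : 'I_n, (i <= j)%N -> v (d j) <= v (d i)) &
      forall s, partial_sum t s = \sum_(i < n | (i < s)%N) logq q (v (d i))]].
Proof.
move=> fr; have lfr := phi_lat_lframe fr; have [lh ph uA] := fr.
have en : n = rank Y by case: lh => bh _; apply: bij_dim bh.
subst n; case=> e [d [/lattice_basis_lframe le d0 ds /lattice_basis_lframe lde td]].
have [Q [gQ hQ]] := lframe_trans lh le.
have [P [gP hP]] := lframe_trans lfr lde.
exists (invmx P), Q, d; split=> //; first exact: glO_inv.
  suff PA : P *m A = diag_mx (\row_i d i) *m Q.
    by rewrite -mulmxA -PA mulKmx // (glO_unit gP).
  apply/row_matrixP => i; rewrite !rowE; have [bh _] := lh.
  apply: (bij_inj bh); rewrite !mulmxA -hQ -[LHS]/((h \o mulmxr A) _) -hP.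
  apply: eq_bigr => j _; rewrite mul_mx_diag tnth_mktuple scalerA.
  by rewrite !mxE.
by split=> // s; apply: eq_bigr => i _; rewrite td.
Qed.

(** Existence excludes the default value [Rge0]. *)
Lemma hodge_typeP (Y : phimod L) n (h : {linear 'rV[L]_n -> Y}) (A : 'M[L]_n) :
  pframe h A -> is_hodge_type v q (hodge_type v q Y).
Proof. by case/hodge_type_exists => t ht; apply: (xgetPex _ (ex_intro _ t ht)). Qed.

Lemma deg_partial_sum (Y : phimod L) :
  deg v q Y = partial_sum (hodge_type v q Y) (rank Y).
Proof. by apply: eq_bigl => i; rewrite ltn_ord. Qed.

Lemma deg_pframe (Y : phimod L) n (h : {linear 'rV[L]_n -> Y}) (A : 'M[L]_n) :
  pframe h A -> deg v q Y = logq q (v (\det A)).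
Proof.
move=> fr; have [P [Q [d [gP gQ AE [d0 _ ps]]]]] := hodge_decomp fr (hodge_typeP fr).
have en : rank Y = n by case: fr => [[bh _] _ _]; apply/esym/(bij_dim bh).
rewrite deg_partial_sum ps en AE !det_mulmx !avM.
have [[_ ->] [_ ->]] := (gP, gQ); rewrite mul1r mulr1 det_diag_row logq_prod //.
by apply: eq_bigl => i; rewrite ltn_ord.
Qed.

(** The minor is required to be nonzero because [ln] takes a default value at 0. *)
Lemma hodge_ge (Y : phimod L) a b (h : {linear 'rV[L]_(a + b) -> Y})
    (A : 'M[L]_(a + b)) :
  pframe h A -> \det (ulsubmx A) != 0 ->
  logq q (v (\det (ulsubmx A))) <= partial_sum (hodge_type v q Y) a.
Proof.
move=> fr ul0; have [P [Q [d [[hP _] [hQ _] AE [d0 ds ps]]]]] :=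
  hodge_decomp fr (hodge_typeP fr).
rewrite ps (le_trans (logq_le (av_gt0 v ul0) (_ : _ <= v (\prod_(i < a) d (lshift b i))))) //.
  by rewrite {1}AE av_prod det_ul_le.
rewrite logq_prod // big_split_ord /= [X in _ <= _ + X]big1 ?addr0 => [|i]; last first.
  by rewrite ltnNge leq_addr.
by rewrite le_eqVlt; apply/orP; left; apply/eqP/eq_bigl => i; rewrite ltn_ord.
Qed.

End Phi.
End Frames.

(** * Adapted bases and exact sequences *)

Section Exactness.
Context (R : realType) (L : fieldType) (v : absval R L).
Context (q : nat) (F : {rmorphism L -> L}).
Hypotheses (q1 : (1 < q)%N) (hF : forall x, F x = x ^+ q).

Lemma mem_vbasis_comb (V : vectType L) (U : {vspace V}) y :
  y \in U <-> exists z, y = comb (tnth (vbasis U)) z.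
Proof.
split=> [yU|[z ->]].
  exists (\row_i coord (vbasis U) i y); rewrite {1}(coord_vbasis yU).
  by apply: eq_bigr => i _; rewrite mxE (tnth_nth 0).
apply: rpred_sum => i _; apply: rpredZ; apply: vbasis_mem; exact: mem_tnth.
Qed.

Lemma comb_vbasis_inj (V : vectType L) (U : {vspace V}) z :
  comb (tnth (vbasis U)) z = 0 -> z = 0.
Proof.
move=> z0; apply/rowP => i; rewrite mxE.
have /freeP := basis_free (vbasisP U); apply.
by rewrite -[RHS]z0; apply: eq_bigr => j _; rewrite (tnth_nth 0).
Qed.

(** Write a basis of [U] in lattice coordinates as a matrix B. The Smith form P B Q = (D 0) has D
    invertible, so the first rows of Q^-1 span [U] while all its rows form a lattice basis. *)
Lemma adapted_pframe (X : phimod L) n (h0 : {linear 'rV[L]_n -> X}) A0 (U : {vspace X}) :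
  pframe v F h0 A0 ->
  exists b (h : {linear 'rV[L]_(\dim U + b) -> X}) A,
    pframe v F h A /\ forall y, y \in U <-> exists x, y = h (row_mx x 0).
Proof.
move=> [lh ph uA]; have [bh _] := lh.
have [b en] : exists b, n = (\dim U + b)%N.
  by exists (n - \dim U)%N; rewrite subnKC // (bij_dim bh) dimvS ?subvf.
subst n; have [B hB] := linear_mx (comb (tnth (vbasis U))) bh.
have [c [c0 cB]] := mx_bounded v B.
have [P [Q [d [gP gQ PBQ _ _]]]] := smith c0 cB.
have uP := glO_unit gP; have uQ := glO_unit gQ.
pose D : 'M[L]_(\dim U) := diag_mx (\row_i d i).
have DE : rdiag (\dim U) (\dim U + b) d = row_mx D 0.
  apply/matrixP => i j; case: (split_ordP j) => k ->.
    rewrite row_mxEl !mxE /=; case: (i =P k) => [->|/val_eqP/eqP ik].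
      by rewrite eqxx mulr1n.
    by rewrite (introF eqP ik) mulr0n.
  by rewrite row_mxEr !mxE /= ltn_eqF // (leq_trans (ltn_ord i)) // leq_addr.
have uD : D \in unitmx.
  rewrite -row_free_unit; apply: inj_row_free => x xD.
  apply: (can_inj (mulmxK uP)); rewrite mul0mx.
  apply: (@comb_vbasis_inj _ U); rewrite hB.
  rewrite -[_ *m B](mulmxK uQ) -!mulmxA (mulmxA P) (mulmxA (P *m B)) PBQ DE.
  by rewrite !mulmxA mul_mx_row xD mulmx0 row_mx0 mul0mx linear0.
(* The change of basis is a twisted conjugation: semilinearity applies [F] to the left factor
   only. *)
exists b, (h0 \o mulmxr (invmx Q)), (map_mx F (invmx Q) *m A0 *m Q); split.
  split; first by apply: lframe_change => //; apply: glO_inv.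
    by move=> x /=; rewrite ph map_mxM !mulmxA mulmxK.
  by rewrite !unitmx_mul uA uQ map_unitmx unitmx_inv uQ.
move=> y; rewrite mem_vbasis_comb; split=> [[z ->]|[x ->]].
  exists (z *m invmx P *m D); rewrite /= hB; congr (h0 _).
  rewrite -[0](mulmx0 _ (z *m invmx P)) -mul_mx_row -DE -PBQ.
  by rewrite -!mulmxA (mulmxA P) !mulmxA !mulmxK // mulmxKV.
exists (x *m invmx D *m P); rewrite /= hB; congr (h0 _).
rewrite -[RHS](mulmxK uQ) -!mulmxA (mulmxA P) (mulmxA (P *m B)) PBQ DE.
by rewrite !mulmxA mul_mx_row mulmx0 mulmxKV.
Qed.

Definition framed (X : phimod L) :=
  exists n (h : {linear 'rV[L]_n -> X}) A, pframe v F h A.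

Lemma bijective_inj_surj (T T' : Type) (f : T -> T') :
  injective f -> (forall y, exists x, f x = y) -> bijective f.
Proof.
move=> fi /choice[g fg]; exists g => // x.
by apply: fi; rewrite fg.
Qed.

Lemma mxO_row m a b (x : 'M[L]_(m, a)) (y : 'M[L]_(m, b)) :
  mxO v (row_mx x y) <-> mxO v x /\ mxO v y.
Proof.
split=> [h|[hx hy] i j]; last by case: (split_ordP j) => k ->; rewrite ?row_mxEl ?row_mxEr.
by split=> i j; [have := h i (lshift b j)|have := h i (rshift a j)];
  rewrite ?row_mxEl ?row_mxEr.
Qed.

Lemma mxO0 m n : mxO v (0 : 'M[L]_(m, n)).
Proof. by move=> i j; rewrite mxE av0 ler01. Qed.

Lemma sub_pframe (X Y : phimod L) (f : {linear Y -> X}) a b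
    (h : {linear 'rV[L]_(a + b) -> X}) A :
  pframe v F h A -> injective f ->
  (forall y, f (pm_phi y) = pm_phi (f y)) ->
  (forall y, pm_lat y <-> pm_lat (f y)) ->
  (forall x, (exists y, x = f y) <-> exists z, x = h (row_mx z 0)) ->
  ursubmx A = 0 /\ exists hY : {linear 'rV[L]_a -> Y}, pframe v F hY (ulsubmx A).
Proof.
move=> [[bh lh] ph uA] fi fphi flat fim.
have y_ (i : 'I_a) : exists y, h (row_mx (delta_mx 0 i) 0) = f y.
  by apply/fim; exists (delta_mx 0 i).
have {y_}[y hy] := choice y_.
pose hY : {linear 'rV[L]_a -> Y} := comb y.
have fhY x : f (hY x) = h (row_mx x 0).
  have -> : row_mx x 0 = x *m row_mx 1%:M 0 :> 'rV_(a + b).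
    by rewrite mul_mx_row mulmx1 mulmx0.
  rewrite -[RHS]/((h \o mulmxr _) x) [RHS]linear_comb.
  rewrite -[hY x]/(\sum_i x 0 i *: y i) linear_sum.
  apply: eq_bigr => i _; rewrite linearZ /= -hy; congr (_ *: h _).
  by rewrite mul_mx_row mulmx1 mulmx0.
have fphY x : f (pm_phi (hY x)) =
    h (row_mx (map_mx F x *m ulsubmx A) (map_mx F x *m ursubmx A)).
  rewrite fphi fhY ph map_row_mx map_mx0 -[A in LHS]submxK mul_row_block.
  by rewrite !mul0mx !addr0.
have ur0 : ursubmx A = 0.
  apply/row_matrixP => i; rewrite row0 rowE -(map_delta F).
  have [z] := (fim (f (pm_phi (hY (delta_mx 0 i))))).1 (ex_intro _ _ erefl).
  by rewrite fphY => /(bij_inj bh)/eq_row_mx[].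
split=> //; exists hY; split.
- split=> [|x]; last by rewrite flat fhY lh mxO_row; split=> [[]|] //; split=> //; apply: mxO0.
  apply: bijective_inj_surj => [x x' /(congr1 f)|u].
    by rewrite !fhY => /(bij_inj bh)/eq_row_mx[].
  have [z zE] := (fim (f u)).1 (ex_intro _ u erefl).
  by exists z; apply: fi; rewrite fhY.
- by move=> x; apply: fi; rewrite fphY ur0 mulmx0 fhY.
- by move: uA; rewrite -[A in A \in _]submxK ur0 !unitmxE det_lblock unitrM => /andP[].
Qed.

Lemma quot_pframe (X Z : phimod L) (g : {linear X -> Z}) a b
    (h : {linear 'rV[L]_(a + b) -> X}) A :
  pframe v F h A -> ursubmx A = 0 ->
  (forall z, exists x, g x = z) ->
  (forall x, g (pm_phi x) = pm_phi (g x)) ->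
  (forall z, pm_lat z <-> exists2 x, pm_lat x & g x = z) ->
  (forall x, g x = 0 <-> exists z, x = h (row_mx z 0)) ->
  exists hZ : {linear 'rV[L]_b -> Z}, pframe v F hZ (drsubmx A).
Proof.
move=> [[bh lh] ph uA] ur0 gs gphi glat gker.
pose hZ : {linear 'rV[L]_b -> Z} := g \o h \o mulmxr (row_mx 0 1%:M).
have hZE y : hZ y = g (h (row_mx 0 y)) by rewrite /= mul_mx_row mulmx0 mulmx1.
have ghE x y : g (h (row_mx x y)) = hZ y.
  have -> : row_mx x y = row_mx x 0 + row_mx 0 y by rewrite add_row_mx addr0 add0r.
  rewrite !linearD /= -[RHS]add0r; congr (_ + _).
    by apply/gker; exists x.
  by rewrite mul_mx_row mulmx0 mulmx1.
have hZi : injective hZ.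
  move=> x y /eqP; rewrite -subr_eq0 -linearB hZE => /eqP/gker[z].
  by move=> /(bij_inj bh)/eq_row_mx[_ /eqP]; rewrite subr_eq0 => /eqP.
have [k kh hk] := bh.
have gE x : g x = hZ (rsubmx (k x)) by rewrite -(ghE (lsubmx (k x))) hsubmxK hk.
exists hZ; split.
- split=> [|y].
    apply: bijective_inj_surj => // z; have [x <-] := gs z.
    by exists (rsubmx (k x)).
  rewrite glat; split=> [[x xM]|hy].
    rewrite gE => /hZi <-; move: xM; rewrite -{1}[x]hk lh => xM i j.
    by rewrite mxE.
  by exists (h (row_mx 0 y)) => //; apply/lh/mxO_row; split=> //; apply: mxO0.
- move=> y; rewrite hZE -gphi ph map_row_mx map_mx0 -[A in LHS]submxK.
  by rewrite mul_row_block !mul0mx !add0r ghE.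
- by move: uA; rewrite -[A in A \in _]submxK ur0 !unitmxE det_lblock unitrM => /andP[].
Qed.

(** The lattice of [Y] is the full preimage of that of [X]; with an adapted frame, this makes the
    image of the lattice a direct summand. *)
Definition embeds (X Y : phimod L) (f : {linear Y -> X}) :=
  [/\ injective f, forall y, f (pm_phi y) = pm_phi (f y) &
      forall y, pm_lat y <-> pm_lat (f y)].

Lemma embeds_pframe (X Y : phimod L) (f : {linear Y -> X}) : framed X -> embeds f ->
  exists b (h : {linear 'rV[L]_(rank Y + b) -> X}) A,
  [/\ pframe v F h A, ursubmx A = 0,
     forall x, (exists y, x = f y) <-> exists z, x = h (row_mx z 0) &
     exists hY : {linear 'rV[L]_(rank Y) -> Y}, pframe v F hY (ulsubmx A)].
Proof.
move=> [n [h0 [A0 fr0]]] [fi fphi flat].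
have [b [h [A [fr hU]]]] := adapted_pframe (limg (linfun f)) fr0.
have fim x : (exists y, x = f y) <-> exists z, x = h (row_mx z 0).
  rewrite -hU; split=> [[y ->]|/memv_imgP[y _ ->]]; last by exists y; rewrite lfunE.
  by apply/memv_imgP; exists y; rewrite ?memvf ?lfunE.
have [ur0 [hY frY]] := sub_pframe fr fi fphi flat fim.
have e : \dim (limg (linfun f)) = rank Y by case: frY => [[bY _] _ _]; apply: bij_dim bY.
(* The size of the frame equals [rank Y] only propositionally, so all that depends on it is
   generalized before substitution. *)
move: (\dim _) e h A fr {hU} fim ur0 hY frY => a e; subst a => h A fr fim ur0 hY frY.
by exists b, h, A; split=> //; exists hY.
Qed.

Lemma embeds_framed (X Y : phimod L) (f : {linear Y -> X}) :
  framed X -> embeds f -> framed Y.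
Proof.
by move=> fX /(embeds_pframe fX)[b [h [A [_ _ _ [hY]]]]]; exists (rank Y), hY, (ulsubmx A).
Qed.

Lemma embeds_deg_le (X Y : phimod L) (f : {linear Y -> X}) : framed X -> embeds f ->
  deg v q Y <= partial_sum (hodge_type v q X) (rank Y).
Proof.
move=> fX /(embeds_pframe fX)[b [h [A [fr _ _ [hY frY]]]]].
rewrite (deg_pframe q1 hF frY) (hodge_ge q1 hF fr) //.
by rewrite -unitfE -unitmxE; case: frY.
Qed.

(** Serves the step of the filtration equal to the whole lattice: its [sub_phimod] lives on a
    subspace type distinct from [X]. *)
Lemma embeds_deg_eq (X Y : phimod L) (f : {linear Y -> X}) : framed X -> embeds f ->
  rank Y = rank X -> deg v q Y = deg v q X.
Proof.
move=> fX /(embeds_pframe fX)[b [h [A [fr ur0 _ [hY frY]]]]] rYX.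
have b0 : b = 0%N.
  have : (rank Y + b)%N = rank X by case: fr => [[bX _] _ _]; apply: bij_dim bX.
  by rewrite -rYX -[RHS]addn0 => /addnI.
subst b; rewrite (deg_pframe q1 hF frY) (deg_pframe q1 hF fr).
by rewrite -[A in RHS]submxK ur0 det_lblock [\det (drsubmx A)]det_mx00 mulr1.
Qed.

Lemma exact_deg (X Y Z : phimod L) (f : {linear Y -> X}) (g : {linear X -> Z}) :
  framed X -> embeds f ->
  (forall z, exists x, g x = z) ->
  (forall x, g (pm_phi x) = pm_phi (g x)) ->
  (forall z, pm_lat z <-> exists2 x, pm_lat x & g x = z) ->
  (forall x, g x = 0 <-> exists y, x = f y) ->
  deg v q X = deg v q Y + deg v q Z /\ rank X = (rank Y + rank Z)%N.
Proof.
move=> fX /(embeds_pframe fX)[b [h [A [fr ur0 fim [hY frY]]]]] gs gphi glat gker.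
have [|hZ frZ] := quot_pframe fr ur0 gs gphi glat.
  by move=> x; rewrite gker fim.
have eZ : b = rank Z by case: frZ => [[bZ _] _ _]; apply: bij_dim bZ.
have eX : (rank Y + b)%N = rank X by case: fr => [[bX _] _ _]; apply: bij_dim bX.
split; last by rewrite -eX eZ.
rewrite (deg_pframe q1 hF fr) (deg_pframe q1 hF frY) (deg_pframe q1 hF frZ).
rewrite -[A in LHS]submxK ur0 det_lblock avM logqM //; apply: av_gt0.
  by rewrite -unitfE -unitmxE; case: frY.
by rewrite -unitfE -unitmxE; case: frZ.
Qed.

Lemma deg_rank0 (X : phimod L) : rank X = 0%N -> deg v q X = 0.
Proof. by move=> r0; rewrite /deg big1 // => i; have := ltn_ord i; rewrite [X in (_ < X)%N]r0. Qed.

End Exactness.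

Local Open Scope classical_set_scope.

(** * Spans of submodules and saturation *)

Section Saturation.
Context (R : realType) (L : fieldType) (v : absval R L).

(** A subspace of maximal dimension inside [S] contains every vector of [S], since adjoining the
    line of such a vector stays inside [S]. *)
Lemma vspace_of_set (V : vectType L) (S : set V) :
  S 0 -> (forall a x y, S x -> S y -> S (a *: x + y)) ->
  exists U : {vspace V}, forall x, x \in U <-> S x.
Proof.
move=> S0 Slin.
pose P d := `[< exists U : {vspace V}, \dim U = d /\ forall x, x \in U -> S x >].
have exP : exists d, P d.
  by exists 0%N; apply/asboolP; exists 0%VS; rewrite dimv0; split=> // x; rewrite memv0 => /eqP ->.
have ubP d : P d -> (d <= \dim {:V})%N.
  by move=> /asboolP[U [<- _]]; rewrite dimvS ?subvf.
case: (ex_maxnP exP ubP) => d /asboolP[U [dU US]] dmax.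
exists U => x; split=> [/US //|xS].
have /dmax : P (\dim (<[x]> + U)%VS).
  apply/asboolP; exists (<[x]> + U)%VS; split=> // y /memv_addP[_ /vlineP[k ->] [u uU ->]].
  by apply: Slin => //; apply: US.
rewrite -dU => dle; have /eqP -> : U == (<[x]> + U)%VS by rewrite eqEdim addvSr.
by rewrite (subvP (addvSl _ _)) ?memv_line.
Qed.

Lemma submoduleZ (V : vectType L) (N : set V) a x :
  is_submodule v N -> v a <= 1 -> N x -> N (a *: x).
Proof.
move=> [N0 Nl] ha Nx; have := Nl (VRing (ha : a \in av_le1 v)) x 0 Nx N0.
by rewrite /= addr0.
Qed.

Lemma submoduleD (V : vectType L) (N : set V) x y :
  is_submodule v N -> N x -> N y -> N (x + y).
Proof. by move=> [_ Nl] Nx Ny; have := Nl 1 x y Nx Ny; rewrite /= scale1r. Qed.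

Lemma submodule_rescale (V : vectType L) (N : set V) a b x :
  is_submodule v N -> b != 0 -> v a <= v b -> N (b *: x) -> N (a *: x).
Proof.
move=> sN b0 ab Nbx; rewrite -[a](divfK b0) -scalerA; apply: submoduleZ => //.
by rewrite avM avV ler_pdivrMr ?av_gt0 // mul1r.
Qed.

(** Two vectors with multiples in [N] have a common multiplier, the smaller of the two in absolute
    value. The vectors of this kind thus form a subspace, so the [xget] in [kspan] has a genuine
    value. *)
Lemma mem_kspan (V : vectType L) (N : set V) x : is_submodule v N ->
  x \in kspan N <-> exists a, a != 0 /\ N (a *: x).
Proof.
move=> sN; pose S : set V := [set x | exists a, a != 0 /\ N (a *: x)].
have S0 : S 0 by exists 1; rewrite oner_eq0 scaler0; case: sN.
have Slin a y z : S y -> S z -> S (a *: y + z).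
  have SD y' z' : S y' -> S z' -> S (y' + z').
    wlog le : y' z' / exists a b, [/\ a != 0, b != 0, v a <= v b & N (a *: y') /\ N (b *: z')].
      move=> W Sy Sz; have [[b [b0 Nb]] [c [c0 Nc]]] := (Sy, Sz).
      have [bc|/ltW cb] := leP (v b) (v c); first by apply: W => //; exists b, c.
      by rewrite addrC; apply: W => //; exists c, b.
    move=> _ _; case: le => b [c [b0 c0 bc [Nb Nc]]]; exists b; split=> //.
    by rewrite scalerDr; apply: submoduleD => //; apply: submodule_rescale Nc.
  move=> [b [b0 Nb]] Sz; apply: SD => //.
  have [->|a0] := eqVneq a 0; first by rewrite scale0r.
  by exists (b / a); rewrite mulf_neq0 ?invr_eq0 // scalerA divfK.
have [U US] := vspace_of_set S0 Slin.
have NU y : N y -> y \in U.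
  by move=> Ny; apply/US; exists 1; rewrite oner_eq0 scale1r.
have Umin (U' : {vspace V}) : (forall y, N y -> y \in U') -> (U <= U')%VS.
  move=> NU'; apply/subvP => y /US[a [a0 /NU' h]].
  by rewrite -[y]scale1r -(mulVf a0) -scalerA memvZ.
have [kN kmin] : (forall y, N y -> y \in kspan N) /\
    (forall U' : {vspace V}, (forall y, N y -> y \in U') -> (kspan N <= U')%VS).
  rewrite /kspan; case: xgetP => [W _ //|/(_ U) []]; by split.
suff -> : kspan N = U by rewrite US.
by apply: subv_anti; rewrite Umin // kmin.
Qed.

(** Some nonzero multiple of [x] lies in [N], so the same multiple of its component in the
    complement lies in both summands and vanishes; a vector space has no torsion. *)
Lemma direct_summand_saturated (V : vectType L) (M N : set V) x :
  is_direct_summand v M N -> N x <-> M x /\ x \in kspan N.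
Proof.
move=> [sN [N' [sN' MNN' NN'0]]]; split=> [Nx|[Mx]].
  split; first by apply/MNN'; exists x, 0; rewrite addr0; split=> //; case: sN'.
  by apply/(mem_kspan x sN); exists 1; rewrite oner_eq0 scale1r.
have /MNN'[y [z [Ny N'z xE]]] := Mx.
move=> /(mem_kspan x sN)[a [a0 Nax]].
(* The multiplier [a] need not be integral: [c] is integral to act on [N] and [N'], and no larger
   than [a] to keep [c *: x] in [N]. *)
have [c [c0 c1 ca]] : exists c, [/\ c != 0, v c <= 1 & v c <= v a].
  have [a1|/ltW a1] := leP (v a) 1; first by exists a.
  by exists 1; rewrite oner_neq0 av1.
have Nz : N (c *: z).
  have -> : c *: z = c *: x + (- c) *: y by rewrite xE scalerDr scaleNr addrC addKr.
  apply: submoduleD => //; first exact: submodule_rescale Nax.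
  by apply: submoduleZ => //; rewrite avN.
have /NN'0 : N (c *: z) by [].
move=> /(_ (submoduleZ sN' c1 N'z))/eqP; rewrite scaler_eq0 (negbTE c0) /= => /eqP z0.
by rewrite xE z0 addr0.
Qed.

End Saturation.

(** * Subobjects and subquotients as exact sequences *)

Section Subquotients.
Context (R : realType) (L : fieldType) (v : absval R L).
Context (q : nat) (F : {rmorphism L -> L}).
Hypotheses (q1 : (1 < q)%N) (hF : forall x, F x = x ^+ q).

Lemma quot_proj_linear (V : vectType L) (U : {vspace V}) : linear (quot_proj U).
Proof.
move=> a x y; rewrite /quot_proj -linearP; congr vsproj.
by rewrite linearP scalerBr opprD addrACA.
Qed.

HB.instance Definition _ (V : vectType L) (U : {vspace V}) :=
  GRing.isLinear.Build L _ _ _ (quot_proj U) (@quot_proj_linear V U).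

Lemma quot_projK (V : vectType L) (U : {vspace V}) x :
  vsval (quot_proj U x) = x - projv U x.
Proof.
by rewrite /quot_proj vsprojK // memv_projC.
Qed.

Lemma quot_proj_eq0 (V : vectType L) (U : {vspace V}) x :
  quot_proj U x = 0 <-> x \in U.
Proof.
split=> [/(congr1 vsval)|xU].
  by rewrite quot_projK linear0 => /eqP; rewrite subr_eq0 => /eqP ->; apply: memv_proj.
by apply: subvs_inj; rewrite quot_projK projv_id // subrr linear0.
Qed.

Lemma quot_proj_vsval (V : vectType L) (U : {vspace V}) (z : subvs_of (U^C)%VS) :
  quot_proj U (vsval z) = z.
Proof.
apply: subvs_inj; rewrite quot_projK.
have /eqP -> : projv U (vsval z) == 0 by rewrite -memv_ker lker_proj subvsP.
by rewrite subr0.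
Qed.

Lemma framed_phiD (X : phimod L) (x y : X) :
  framed v F X -> pm_phi (x + y) = pm_phi x + pm_phi y.
Proof.
move=> [n [h [A [[[g gh hg] _] ph _]]]].
rewrite -[x]hg -[y]hg -linearD !ph map_mxD mulmxDl linearD.
by [].
Qed.

(** The working form of strictness: [N] is the set of lattice points of its span. Stability is an
    inclusion; the block triangular determinant turns it into invertibility of the restricted
    Frobenius. *)
Record saturated (X : phimod L) (N : set X) : Prop := Saturated {
  sat_mod : is_submodule v N;
  sat_lat : forall x, N x <-> pm_lat x /\ x \in kspan N;
  sat_phi : forall x, x \in kspan N -> pm_phi x \in kspan N }.

Lemma strict_saturated (X : phimod L) (N : set X) : is_strict_sub v N -> saturated N.
Proof.
move=> [dN sN]; split=> [|x|x xN]; first by case: dN.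
  exact: direct_summand_saturated dN.
suff : [set x | x \in kspan N] (pm_phi x) by [].
by rewrite -sN; exists x.
Qed.

Lemma sub_embeds (X : phimod L) (N : set X) : saturated N ->
  embeds (X := X) (Y := sub_phimod N) (@vsval L X (kspan N)).
Proof.
move=> sN; split=> [x y /val_inj //|y|y].
  by rewrite /= vsprojK // (sat_phi sN) // subvsP.
by split=> [/(sat_lat sN)[]//|h]; apply/(sat_lat sN); split=> //; apply: subvsP.
Qed.

Lemma subquot_exact (X : phimod L) (N N' : set X) : framed v F X ->
  saturated N -> saturated N' -> (N' `<=` N) ->
  deg v q (sub_phimod N) = deg v q (sub_phimod N') + deg v q (subquot_phimod N N') /\
  rank (sub_phimod N) = (rank (sub_phimod N') + rank (subquot_phimod N N'))%N.
Proof.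
move=> fX sN sN' N'N; have fN := embeds_framed fX (sub_embeds sN).
have kN'N x : x \in kspan N' -> x \in kspan N.
  move=> /(mem_kspan x (sat_mod sN'))[a [a0 /N'N h]].
  by apply/(mem_kspan x (sat_mod sN)); exists a.
pose N'' : set (sub_phimod N) := [set x | N' (vsval x)].
have sN'' : is_submodule v N''.
  have [N0 Nl] := sat_mod sN'; split=> [|a x y hx hy]; first exact: N0.
  exact: (Nl a (vsval x) (vsval y)).
(* The subquotient is formed inside [sub_phimod N], so the span computed there must be matched with
   the span of [N'] in [X]. *)
have kN'' x : x \in kspan N'' <-> vsval x \in kspan N'.
  rewrite (mem_kspan x sN'') (mem_kspan _ (sat_mod sN')).
  by split=> [] [a [a0 h]]; exists a.
pose f : {linear sub_phimod N' -> sub_phimod N} := vsproj (kspan N) \o vsval.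
have fE y : vsval (f y) = vsval y by rewrite /= vsprojK // kN'N // subvsP.
pose g : {linear sub_phimod N -> subquot_phimod N N'} := quot_proj (kspan N'').
apply: (@exact_deg R L v q F q1 hF (sub_phimod N) (sub_phimod N') (subquot_phimod N N') f g) => //.
- split=> [x y /(congr1 vsval)|y|y].
  + by rewrite !fE => /val_inj.
  + have hy := sat_phi sN' (subvsP y).
    apply: subvs_inj; rewrite fE /= (vsprojK hy) (vsprojK (kN'N _ (subvsP y))).
    by rewrite vsprojK // kN'N.
  + rewrite /= -[vsval (vsproj _ _)]/(vsval (f y)) fE; split=> [/N'N //|].
    by move=> /(sat_lat sN)[My _]; apply/(sat_lat sN'); split=> //; apply: subvsP.
- by move=> z; exists (vsval z); apply: quot_proj_vsval.
(* The quotient Frobenius is evaluated on the representative in the complement. It differs from [x]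
   by a vector of the span of [N''], whose Frobenius stays in that span and dies in the quotient. *)
- move=> x; rewrite /=.
  have xE : x = projv (kspan N'') x + vsval (quot_proj (kspan N'') x).
    by rewrite quot_projK addrC subrK.
  rewrite -[vsproj _ _]/(pm_phi x) {1}xE framed_phiD // linearD /=.
  rewrite [X in X + _](_ : _ = 0) ?add0r //; apply/quot_proj_eq0/kN''.
  have /kN'' hp := memv_proj (kspan N'') x.
  by rewrite vsprojK ?(sat_phi sN') // kN'N // (sat_phi sN').
- move=> x; rewrite quot_proj_eq0 kN''; split=> [hx|[y ->]]; last by rewrite fE subvsP.
  by exists (vsproj (kspan N') (vsval x)); apply: subvs_inj; rewrite fE vsprojK.
Qed.

End Subquotients.

(** * Majorization in terms of excess sums *)

Section Majorization.
Context (R : realType) (r : nat).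

Lemma sum_ltn_const (c : R) k : (k <= r)%N -> \sum_(i < r | (i < k)%N) c = c * k%:R.
Proof.
move=> kr.
by rewrite -(big_ord_widen r (fun=> c) kr) sumr_const card_ord mulr_natr.
Qed.

Lemma Rge_nonincr (t : Rge R r) (i j : 'I_r) :
  (i <= j)%N -> tnth (val t) j <= tnth (val t) i.
Proof.
move=> ij; rewrite !(tnth_nth 0).
apply: (sorted_leq_nth (leT := fun x y : R => y <= x)) ij.
- by move=> x y z yx zy; apply: le_trans yx.
- by move=> x; apply: lexx.
- exact: (valP t).
- by rewrite inE size_tuple.
- by rewrite inE size_tuple.
Qed.

(* Legendre duality: the sum of the s largest entries of h is the minimum over
   gamma of gamma * s + \sum_i max (h_i - gamma) 0, attained at the s-th entry. *)
Lemma Rge_le_excess (t h : Rge R r) :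
  partial_sum t r = partial_sum h r ->
  (forall gamma, \sum_(i < r) Num.max (tnth (val t) i - gamma) 0 <=
                 \sum_(i < r) Num.max (tnth (val h) i - gamma) 0) ->
  Rge_le t h.
Proof.
move=> teq tle; split=> // -[|s] sr; first by rewrite /partial_sum !big_pred0.
pose gamma := tnth (val h) (Ordinal sr).
have E (u : Rge R r) : partial_sum u s.+1 =
    \sum_(i < r | (i < s.+1)%N) (tnth (val u) i - gamma) + gamma * s.+1%:R.
  by rewrite -(sum_ltn_const _ sr) -big_split /=; apply: eq_bigr => i _; rewrite subrK.
rewrite !E lerD2r.
have -> : \sum_(i < r | (i < s.+1)%N) (tnth (val h) i - gamma) =
    \sum_(i < r) Num.max (tnth (val h) i - gamma) 0.
  rewrite big_mkcond /=; apply: eq_bigr => i _; case: ltnP => hi.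
    by rewrite max_l // subr_ge0 Rge_nonincr.
  by rewrite max_r // subr_le0 Rge_nonincr //= ltnW.
apply: le_trans (tle gamma); rewrite big_mkcond /=; apply: ler_sum => i _.
by case: ifP => _; rewrite le_max lexx ?orbT.
Qed.

(** The weak half of the duality, later used with [k] the rank of a filtration step. *)
Lemma sum_ltn_excess (h : Rge R r) gamma k : (k <= r)%N ->
  partial_sum h k - gamma * k%:R <= \sum_(i < r) Num.max (tnth (val h) i - gamma) 0.
Proof.
move=> kr; rewrite -(sum_ltn_const _ kr) -sumrB big_mkcond /=; apply: ler_sum => i _.
by case: ifP => _; rewrite le_max lexx ?orbT.
Qed.

End Majorization.

(** * Jumps of the filtration and the Fargues type *)

Section FarguesType.
Context (R : realType) (L : fieldType) (v : absval R L).
Context (q : nat) (F : {rmorphism L -> L}).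
Hypotheses (q1 : (1 < q)%N) (hF : forall x, F x = x ^+ q).
Context (X : phimod L) (Fil : R -> set X).
Hypotheses (fX : framed v F X) (filF : is_filtration v Fil).

Let satF gamma : saturated v (Fil gamma).
Proof. exact: strict_saturated (fil_strict filF gamma). Qed.

Lemma rank_sub (N : set X) : rank (sub_phimod N) = \dim (kspan N).
Proof. by rewrite /rank dimvf. Qed.

Lemma saturated_eq (N N' : set X) : saturated v N -> saturated v N' -> N' `<=` N ->
  (rank (sub_phimod N) <= rank (sub_phimod N'))%N -> N = N'.
Proof.
move=> sN sN' N'N; rewrite !rank_sub => le.
have kN'N : (kspan N' <= kspan N)%VS.
  apply/subvP => x /(mem_kspan x (sat_mod sN'))[a [a0 /N'N h]].
  by apply/(mem_kspan x (sat_mod sN)); exists a.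
have /eqP kE : kspan N' == kspan N by rewrite eqEdim kN'N.
by apply/seteqP; split=> // x /(sat_lat sN)[Mx]; rewrite -kE => kx; apply/(sat_lat sN').
Qed.

(** Ranks are bounded, so some step beyond [gamma] has maximal rank; any larger step beyond [gamma]
    has the same rank, hence equals it by saturation. The union is thus itself a step, and so
    saturated. *)
Lemma fil_gt_attained gamma :
  exists2 gamma', gamma < gamma' & fil_gt Fil gamma = Fil gamma'.
Proof.
pose P d := `[< exists2 g, gamma < g & rank (sub_phimod (Fil g)) = d >].
have exP : exists d, P d.
  by exists (rank (sub_phimod (Fil (gamma + 1)))); apply/asboolP; exists (gamma + 1); rewrite ?ltrDl.
have ubP d : P d -> (d <= rank X)%N.
  by move=> /asboolP[g _ <-]; rewrite rank_sub dimvS ?subvf.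
case: (ex_maxnP exP ubP) => d /asboolP[g gg dE] dmax; exists g => //.
apply/seteqP; split=> [x [g' [gg' xg']]|x xg]; last by exists g.
have [gle|/ltW gle] := leP g g'; first exact: (fil_decr filF gle).
suff -> : Fil g = Fil g' by [].
apply/esym/(saturated_eq (satF g') (satF g)); first by move=> y; apply: (fil_decr filF gle).
by rewrite dE dmax //; apply/asboolP; exists g'.
Qed.

Lemma rank_gr_eq0 gamma gamma' : gamma < gamma' -> Fil gamma `<=` Fil gamma' ->
  rank (gr Fil gamma) = 0%N.
Proof.
move=> lt sub; rewrite /gr.
have -> : fil_gt Fil gamma = Fil gamma.
  apply/seteqP; split=> [x [g [gg]]|x xg]; first exact: (fil_decr filF (ltW gg)).
  by exists gamma'; split=> //; apply: sub.
have [_ /eqP] := subquot_exact q1 hF fX (satF gamma) (satF gamma) (@subset_refl _ _).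
by rewrite -[X in X == _]addn0 eqn_add2l => /eqP.
Qed.

Lemma rank_sub0 : rank (sub_phimod ([set 0] : set X)) = 0%N.
Proof.
have [g0 g0E] := fil_separated filF.
rewrite rank_sub; apply/eqP; rewrite dimv_eq0 -subv0; apply/subvP => x.
have sm : is_submodule v ([set 0] : set X) by rewrite -g0E; apply: sat_mod (satF _).
move=> /(mem_kspan x sm)[a [a0 /eqP]].
by rewrite scaler_eq0 (negbTE a0) memv0.
Qed.

Context (t : seq R).
Hypotheses (ss : forall gamma, deg v q (gr Fil gamma) = gamma * (rank (gr Fil gamma))%:R)
  (tE : forall gamma, count_mem gamma t = rank (gr Fil gamma)).

Let t_jump gamma gamma' : gamma \in t -> gamma < gamma' -> ~ Fil gamma `<=` Fil gamma'.
Proof.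
rewrite -has_pred1 has_count tE => h lt /(rank_gr_eq0 lt) e.
by rewrite e in h.
Qed.

(** Telescoping over the jumps from [gamma] on. The free constant serves twice: [c = 0] gives the
    total degree and [c = gamma] the excess over [gamma]. *)
Lemma fargues_sum c gamma :
  \sum_(x <- t | gamma <= x) (x - c) =
  deg v q (sub_phimod (Fil gamma)) - c * (rank (sub_phimod (Fil gamma)))%:R.
Proof.
have [n] := ubnP (rank (sub_phimod (Fil gamma))).
elim: n gamma => // n IH gamma rn.
have [g0 g0E] := fil_separated filF.
have F0 g : Fil g 0 by have [] := sat_mod (satF g).
have [gE|gN0] := pselect (Fil gamma = [set 0]).
  rewrite gE (deg_rank0 v q rank_sub0) rank_sub0 mulr0 subr0 big_seq_cond big_pred0 //.
  move=> x; apply/negP => /andP[xt gx].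
  have lt : x < x + 1 by rewrite ltrDl.
  apply: (t_jump xt lt) => y /(fil_decr filF gx).
  by rewrite gE => ->; apply: F0.
(* The next jump is the supremum of this set: separation bounds it, and left continuity shows that
   it is attained. *)
pose S := [set g | Fil g = Fil gamma].
have Sub : ubound S g0.
  move=> g gS; rewrite leNgt; apply/negP => lt; apply: gN0; rewrite -gS.
  apply/seteqP; split=> [y /(fil_decr filF (ltW lt))|y ->//]; by rewrite g0E.
have hS : has_sup S by split; [exists gamma|exists g0].
pose s := sup S.
have gs : gamma <= s by apply: sup_upper_bound.
have FsE : Fil s = Fil gamma.
  apply/seteqP; split=> [|x xg]; first by move=> y; apply: (fil_decr filF gs).
  apply: (fil_left_cont filF) => g lt.
  have [u uS gu] := sup_gt (ex_intro _ gamma erefl : S !=set0) lt.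
  by apply: (fil_decr filF (ltW gu)); rewrite uS.
have [s' ss' grE] := fil_gt_attained s.
have sub : Fil s' `<=` Fil s by move=> y; apply: (fil_decr filF (ltW ss')).
have [dE rE] := subquot_exact q1 hF fX (satF s) (satF s') sub.
rewrite -grE -/(gr Fil s) in dE rE.
have rlt : (rank (sub_phimod (Fil s')) < rank (sub_phimod (Fil gamma)))%N.
  rewrite ltnNge; apply/negP => le.
  have : S s' by rewrite /S /= -(saturated_eq (satF s) (satF s') sub) // FsE.
  by move/(sup_upper_bound hS); rewrite leNgt ss'.
have IHs := IH s' (leq_trans rlt rn).
rewrite -FsE dE rE ss natrD.
have -> : \sum_(x <- t | gamma <= x) (x - c) =
    \sum_(x <- t | s' <= x) (x - c) + \sum_(x <- t | x == s) (x - c).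
  rewrite (bigID (fun x => s' <= x)) /=; congr (_ + _).
    apply: eq_bigl => x; rewrite andb_idl // => s'x.
    by rewrite (le_trans gs) // (le_trans (ltW ss')).
  (* The filtration is constant from [gamma] to [s], and again strictly after [s] up to [s']; the
     only possible entry of [t] before [s'] is therefore [s]. *)
  rewrite big_seq_cond [RHS]big_seq_cond; apply: eq_bigl => x.
  case xt : (x \in t) => //=; apply/andP/eqP => [[gx]|->]; last by rewrite -ltNge.
  rewrite -ltNge => xs'; have [xs|sx|//] := ltgtP x s.
    by case: (t_jump xt xs); rewrite FsE => y; apply: (fil_decr filF gx).
  case: (t_jump xt xs') => y yx; rewrite -grE; by exists x.
rewrite IHs (eq_bigr (fun=> s - c)) => [|x /eqP -> //].
rewrite big_const_seq iter_addr addr0 -[count _ _]/(count_mem s t) tE -mulr_natr.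
rewrite -grE; ring.
Qed.

End FarguesType.

(** * The q-power endomorphism and coordinates on X *)

Section FrobeniusMorphism.
Context (R : realType) (L : fieldType) (v : absval R L) (q : nat).

Lemma frobenius_rmorphism : (0 < q)%N ->
  (forall a b : L, (a + b) ^+ q = a ^+ q + b ^+ q) ->
  exists F : {rmorphism L -> L}, forall x, F x = x ^+ q.
Proof.
move=> q0 qD; pose f (x : L) := x ^+ q.
have fB : zmod_morphism f.
  by move=> a b; apply: (addIr (f b)); rewrite -qD !subrK.
have fM : monoid_morphism f by split=> [|a b]; rewrite /f ?expr1n ?exprMn.
pose F : {rmorphism L -> L} := HB.pack f
  (GRing.isZmodMorphism.Build L L f fB) (GRing.isMonoidMorphism.Build L L f fM).
by exists F.
Qed.

Context (X : phimod L).
Hypothesis hX : is_phimod v q X.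

Lemma phimod_phi0 : pm_phi (0 : X) = 0.
Proof.
have := pm_semilinear hX 1 0 0; rewrite scaler0 addr0 expr1n scale1r => /eqP.
by rewrite -subr_eq subrr => /eqP.
Qed.

Lemma phimod_phiZ a (x : X) : pm_phi (a *: x) = a ^+ q *: pm_phi x.
Proof. by have := pm_semilinear hX a x 0; rewrite phimod_phi0 !addr0. Qed.

(* Evaluate pm_phi on (a + b) *: x for a nonzero x. *)
Lemma phimod_frobeniusD : rank X != 0%N ->
  forall a b : L, (a + b) ^+ q = a ^+ q + b ^+ q.
Proof.
move=> r0 a b; have : vpick {:X} != 0 by rewrite vpick0 -dimv_eq0.
set x := vpick _ => x0.
have px0 : pm_phi x != 0.
  apply: contra x0 => /eqP h; apply/eqP/(bij_inj (pm_bij hX)).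
  by rewrite h phimod_phi0.
have /eqP := phimod_phiZ (a + b) x.
rewrite scalerDl (pm_semilinear hX) phimod_phiZ -scalerDl -subr_eq0 -scalerBl.
by rewrite scaler_eq0 (negbTE px0) orbF subr_eq0 => /eqP.
Qed.

Lemma phimod_framed (F : {rmorphism L -> L}) :
  (forall x, F x = x ^+ q) -> framed v F X.
Proof.
move=> hF; have [e /lattice_basis_lframe le] := pm_free hX.
pose h : {linear 'rV[L]_(rank X) -> X} := comb (tnth e); rewrite -/h in le.
have [[g gK Kg] _] := le; have [k kK Kk] := pm_bij hX.
pose A := \matrix_(i < rank X) g (pm_phi (tnth e i)).
have ph x : pm_phi (h x) = h (map_mx F x *m A).
  have phS I (r : seq I) (a : I -> L) (y : I -> X) :
      pm_phi (\sum_(i <- r) a i *: y i) = \sum_(i <- r) a i ^+ q *: pm_phi (y i).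
    elim: r => [|i r IH]; first by rewrite !big_nil phimod_phi0.
    by rewrite !big_cons (pm_semilinear hX) IH.
  transitivity (comb (fun i => pm_phi (tnth e i)) (map_mx F x)).
    by rewrite [LHS]phS; apply: eq_bigr => i _; rewrite mxE hF.
  rewrite -[RHS]/((h \o mulmxr A) _) [RHS]linear_comb; apply: eq_bigr => i _.
  by rewrite /= -rowE rowK Kg.
exists (rank X), h, A; split=> //.
(* The inverse images of the basis vectors under [pm_phi], with [F] applied to their coordinates,
   are the rows of a left inverse of [A]. *)
suff /mulmx1_unit[] : (\matrix_i map_mx F (g (k (h (delta_mx 0 i))))) *m A = 1%:M by [].
apply/row_matrixP => i; rewrite row_mul rowK; apply: (can_inj gK).
by rewrite -ph Kg Kk rowE mulmx1.
Qed.

End FrobeniusMorphism.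

(** * Comparison of the two polygons *)

Lemma fargues_type_le (R : realType) (L : fieldType) (v : absval R L) (q : nat)
    (F : {rmorphism L -> L}) (X : phimod L) (t : Rge R (rank X)) :
  (1 < q)%N -> (forall x, F x = x ^+ q) -> framed v F X ->
  is_fargues_type v q t -> Rge_le t (hodge_type v q X).
Proof.
move=> q1 hF fX [Fil [[filF ssF] tE]].
have ss gamma : deg v q (gr Fil gamma) = gamma * (rank (gr Fil gamma))%:R.
  by have [] := ssF gamma.
have tS := fargues_sum q1 hF fX filF ss tE.
have satF gamma := strict_saturated (fil_strict filF gamma).
have rk gamma : (rank (sub_phimod (Fil gamma)) <= rank X)%N.
  by rewrite rank_sub dimvS ?subvf.
apply: Rge_le_excess => [|gamma].
  rewrite -deg_partial_sum.
  have [g0 g0E] := fil_exhaustive filF.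
  have sub_deg : deg v q (sub_phimod (Fil g0)) = deg v q X.
    apply: (embeds_deg_eq q1 hF fX (sub_embeds (satF g0))).
    suff kT : kspan (Fil g0) = {:X}%VS by rewrite rank_sub kT.
    apply: subv_anti; rewrite subvf; apply/subvP => x _.
    have [n [h [A [[[g gK Kg] lh] _ _]]]] := fX.
    rewrite -[x]Kg linear_comb; apply: rpred_sum => i _; apply: rpredZ.
    apply/(mem_kspan _ (sat_mod (satF g0))); exists 1; rewrite oner_neq0 scale1r g0E.
    split=> //; apply/lh => a b; rewrite mxE.
    by case: (_ && _); rewrite ?av1 ?av0 ?ler01.
  have := tS 0 g0; rewrite mul0r subr0 sub_deg => <-.
  rewrite /partial_sum big_tuple; apply: eq_big => i; last by rewrite subr0.
  (* An entry below [g0] would be a jump, but before [g0] the filtration already equals the whole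
     lattice. *)
  rewrite ltn_ord; apply/esym; rewrite leNgt; apply/negP => lt.
  have : (0 < count_mem (tnth (val t) i) (val t))%N.
    by rewrite -has_count has_pred1 mem_tnth.
  rewrite tE (rank_gr_eq0 q1 hF fX filF lt) // => y.
  by rewrite g0E => /(sat_lat (satF _))[].
have -> : \sum_(i < rank X) Num.max (tnth (val t) i - gamma) 0 =
    \sum_(x <- val t | gamma <= x) (x - gamma).
  rewrite big_tuple [RHS]big_mkcond /=; apply: eq_bigr => i _; case: leP => h.
    by rewrite max_l // subr_ge0.
  by rewrite max_r // subr_le0 ltW.
rewrite tS; apply: le_trans (sum_ltn_excess _ _ (rk gamma)).
by rewrite lerD2r (embeds_deg_le q1 hF fX (sub_embeds (satF gamma))).
Qed.

Theorem corollary27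
  (R : realType) (p q : nat)
  (* E / Q_p finite, with uniformizer pi and residue field k of cardinal q *)
  (Qp : fieldType) (absQp : absval R Qp) (hQp : is_Qp p absQp)
  (E : fieldExtType Qp)
  (* K / E perfectoid *)
  (K : fieldType) (absK : absval R K) (hK : is_perfectoid p absK)
  (iota : {rmorphism E -> K})
  (hiota : forall a : Qp, absK (iota a%:A) = absQp a)
  (pi : vring (av_pull iota absK)) (hpi : is_uniformizer pi)
  (k : finFieldType) (res : {rmorphism vring (av_pull iota absK) -> k})
  (hres : is_residue_map res) (hq : #|k| = q)
  (* L = K^flat *)
  (L : fieldType) (sh : nat -> L -> K) (hL : is_tilt p absK sh)
  (absL : absval R L) (habsL : is_tilt_absval absK sh absL)
  (* theta : W_{O_E}(O_L) ->> O_K, and the normalization of absL *)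
  (W : comNzRingType) (iW : {rmorphism vring (av_pull iota absK) -> W})
  (red : {rmorphism W -> vring absL}) (hW : is_witt pi iW red)
  (tau : vring absL -> W) (htau : is_teichmuller red tau)
  (theta : {rmorphism W -> vring absK}) (htheta : is_theta sh iW tau theta)
  (xi : W) (hxi : is_ker_generator theta xi)
  (hnorm : q%:R * absL ((red xi : L) ^+ q) = 1)
  (* (M, phi_M) *)
  (X : phimod L) (hX : is_phimod absL q X)
  (tF : Rge R (rank X)) (htF : is_fargues_type absL q tF) :
  Rge_le tF (hodge_type absL q X).
Proof.
have q1 : (1 < q)%N by rewrite -hq (cardD1 0) (cardD1 1) !inE oner_eq0.
(* In rank 0 there is no nonzero vector from which to derive additivity of the q-power map; all
   partial sums are empty. *)
have [r0|r0] := eqVneq (rank X) 0%N.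
  have ps0 (t : Rge R (rank X)) s : partial_sum t s = 0.
    by rewrite /partial_sum big1 // => i; have := ltn_ord i; rewrite [X in (_ < X)%N]r0.
  by split=> [s _|]; rewrite !ps0.
have [F hF] := frobenius_rmorphism (ltnW q1) (phimod_frobeniusD hX r0).
exact: fargues_type_le q1 hF (phimod_framed hX hF) htF.
Qed.
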